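(* Let $q\in\{0,\ldots,N-1\}$ and let $D$ be a bounded domain in $\mathbb{C}^N$ with $\mathcal{C}^2$-smooth boundary. Then $$\check{S}_{\mathcal{PSH}_q(\overline{D})}=\check{S}_{\mathcal{PSH}^2_q(\overline{D})}=\overline{\mathcal{S}_q(\overline{D})},$$ where $\mathcal{S}_q(\overline{D})$ is the set of all points $p\in bD$ at which $D$ is strictly $q$-pseudoconvex.
   Context: For a compact set $K$ and a set $\mathcal{A}$ of upper semi-continuous functions $K\to[-\infty,\infty)$ put $S(f):=\{x\in K: f(x)=\max_K f\}$. A closed set $S\subset K$ is a closed boundary for $\mathcal{A}$ if $S\cap S(f)\neq\emptyset$ for all $f\in\mathcal{A}$; the Shilov boundary $\check{S}_{\mathcal{A}}$ is the intersection of all closed boundaries. An upper semi-continuous $u:U\to[-\infty,\infty)$ on an open set $U$ is subpluriharmonic if for every ball $B\Subset U$ and every $h$ pluriharmonic near $\overline{B}$ with $u\le h$ on $bB$ one has $u\le h$ on $B$. It is $q$-plurisubharmonic on $U\subset\mathbb{C}^N$ if it is subpluriharmonic on $U\cap\pi$ for every $(q+1)$-dimensional complex affine plane $\pi$. For compact $K\subset\mathbb{C}^N$, $\mathcal{PSH}_q(K)$ is the set of upper semi-continuous functions on $K$ which extend to a $q$-plurisubharmonic function on some open neighborhood of $K$, and $\mathcal{PSH}^2_q(K)$ is the set of (restrictions to $K$ of) functions which are $\mathcal{C}^2$-smooth and $q$-plurisubharmonic in some neighborhood of $K$. A $\mathcal{C}^2$-smooth function is strictly $q$-plurisubharmonic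 if its complex Hessian has at least $N-q$ positive eigenvalues at each point. $D$ is strictly $q$-pseudoconvex at $p\in bD$ if there are a neighborhood $U$ of $p$ and a $\mathcal{C}^2$-smooth strictly $q$-plurisubharmonic function $\varrho$ on $U$ such that $d\varrho(p)\neq 0$ and $U\cap D=\{z\in U:\varrho(z)<0\}$. *)

(* Defs.v *)
From HB Require Import structures.
From mathcomp Require Import all_boot all_order all_algebra.
From mathcomp Require Import complex.
From mathcomp Require Import all_classical all_reals all_analysis.
Set Implicit Arguments.
Unset Strict Implicit.
Unset Printing Implicit Defensive.
Import Order.TTheory GRing.Theory Num.Theory.
Import numFieldNormedType.Exports.
Local Open Scope classical_set_scope.
Local Open Scope ring_scope.

(* C^N as a real normed space: the pair (x, y) stands for x + i y.  The library
   norm on it is a maximum norm; it is used only for topology, boundedness and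
   real differentiation, never for balls. *)
Notation Cn R N := ('rV[R]_N * 'rV[R]_N)%type.

Section Coordinates.
Variables (R : realType) (N : nat).

Definition toC (z : Cn R N) : 'rV[R[i]]_N :=
  \row_j (z.1 ord0 j +i* z.2 ord0 j)%C.

Definition ofC (w : 'rV[R[i]]_N) : Cn R N :=
  (\row_j complex.Re (w ord0 j), \row_j complex.Im (w ord0 j)).

Definition eball (c : Cn R N) (r : R) : set (Cn R N) :=
  [set z : Cn R N | \sum_j ((z.1 ord0 j - c.1 ord0 j) ^+ 2
                 + (z.2 ord0 j - c.2 ord0 j) ^+ 2) < r ^+ 2].

Definition dirx (j : 'I_N) : Cn R N := (delta_mx ord0 j, 0).
Definition diry (j : 'I_N) : Cn R N := (0, delta_mx ord0 j).

End Coordinates.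

Definition bd (T : topologicalType) (A : set T) : set T :=
  closure A `\` interior A.

Section ShilovBoundary.
Variables (R : realType) (T : topologicalType).
Implicit Types (A K S : set T) (u f : T -> \bar R) (F : set (T -> \bar R)).

(* Functions on A are represented by total functions of which only the
   restriction to A is used; values lie in [-oo, +oo) on A. *)
Definition usc_on A u := forall x, A x ->
  (u x < +oo)%E /\
  (forall a : R, (u x < a%:E)%E -> \forall y \near within A (nbhs x), (u y < a%:E)%E).

Definition argmax_set K f : set T :=
  [set x | K x /\ forall y, K y -> (f y <= f x)%E].

Definition closed_boundary K F S :=
  [/\ closed S, S `<=` K & forall f, F f -> S `&` argmax_set K f !=set0].

Definition shilov K F : set T := \bigcap_(S in closed_boundary K F) S.

End ShilovBoundary.

Section Pluripotential.
Variables (R : realType) (N : nat).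
Implicit Types (U K D : set (Cn R N)) (h rho : Cn R N -> R)
  (u : Cn R N -> \bar R).

(* All directions are allowed, not only the coordinate ones; for open U this
   does not change the class. *)
Definition C2_on U h := forall z, U z ->
  [/\ {for z, continuous h},
      forall v, derivable h z v /\ {for z, continuous ('D_v h)} &
      forall v w, derivable ('D_v h) z w /\
                  {for z, continuous ('D_w ('D_v h))}].

(* d^2 h / dz_j d\bar z_k, with d/dz = (d/dx - i d/dy) / 2 and
   d/d\bar z = (d/dx + i d/dy) / 2. *)
Definition cplx_hessian h (z : Cn R N) : 'M[R[i]]_N :=
  \matrix_(j, k)
    ((('D_(dirx R j) ('D_(dirx R k) h) z + 'D_(diry R j) ('D_(diry R k) h) z) / 4)
     +i*
     (('D_(dirx R j) ('D_(diry R k) h) z - 'D_(diry R j) ('D_(dirx R k) h) z) / 4))%C.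

Definition pluriharmonic_on U h :=
  C2_on U h /\ forall z, U z -> cplx_hessian h z = 0.

Definition subpluriharmonic_on U u :=
  usc_on U u /\
  forall (c : Cn R N) (r : R), 0 < r -> closure (eball c r) `<=` U ->
  forall (W : set (Cn R N)) (h : Cn R N -> R),
    open W -> closure (eball c r) `<=` W -> pluriharmonic_on W h ->
    (forall z, bd (eball c r) z -> (u z <= (h z)%:E)%E) ->
    forall z, eball c r z -> (u z <= (h z)%:E)%E.

(* Eigenvalues are counted with algebraic multiplicity; 0 < a in R[i] means
   that a is real and positive. *)
Definition at_least_pos_eigenvalues (k : nat) (A : 'M[R[i]]_N) :=
  exists s : seq R[i],
    char_poly A = \prod_(a <- s) ('X - a%:P) /\
    (k <= count (fun a => (0 < a :> R[i])%R) s)%N.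

Definition strictly_qpsh_on (q : nat) U rho :=
  C2_on U rho /\
  forall z, U z -> at_least_pos_eigenvalues (N - q) (cplx_hessian rho z).

(* rho is a C^2 defining function of D on the open neighbourhood U of p *)
Definition C2_defining D (p : Cn R N) U rho :=
  [/\ open U, U p, C2_on U rho,
      exists v, 'd rho p v != 0 & U `&` D = [set z | U z /\ rho z < 0]].

Definition C2_boundary D :=
  forall p, bd D p -> exists U rho, C2_defining D p U rho.

Definition strictly_qpseudoconvex_at (q : nat) D (p : Cn R N) :=
  exists U rho, C2_defining D p U rho /\ strictly_qpsh_on q U rho.

Definition strictly_qpseudoconvex_points (q : nat) D : set (Cn R N) :=
  [set p | bd D p /\ strictly_qpseudoconvex_at q D p].

End Pluripotential.

(* The rows of a unitary A : 'M_(k, N) form a Hermitian-orthonormal family, so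
   w |-> a + w A is an isometry of C^k onto a k-dimensional complex affine plane,
   and every such plane arises in this way. *)
Definition affine_plane (R : realType) (k N : nat) (a : Cn R N)
    (A : 'M[R[i]]_(k, N)) (w : Cn R k) : Cn R N :=
  ofC (toC a + toC w *m A).

Section QPlurisubharmonic.
Variables (R : realType) (N : nat).
Implicit Types (U K : set (Cn R N)) (u : Cn R N -> \bar R).

Definition qpsh_on (q : nat) U u :=
  usc_on U u /\
  forall (a : Cn R N) (A : 'M[R[i]]_(q.+1, N)), A \is unitarymx ->
    subpluriharmonic_on (affine_plane a A @^-1` U) (u \o affine_plane a A).

Definition PSH (q : nat) K : set (Cn R N -> \bar R) :=
  [set f | usc_on K f /\
     exists V v, [/\ open V, K `<=` V, qpsh_on q V v &
                     forall z, K z -> f z = v z]].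

Definition PSH2 (q : nat) K : set (Cn R N -> \bar R) :=
  [set f | exists V (g : Cn R N -> R),
     [/\ open V, K `<=` V, C2_on V g, qpsh_on q V (EFin \o g) &
         forall z, K z -> f z = (g z)%:E]].

End QPlurisubharmonic.

(* Main.v *)
(* Strictly q-pseudoconvex points are peak points: cut off a strictly
   q-plurisubharmonic local defining function, minus a multiple of |z - p|^2, by
   a convex increasing C^2 function that vanishes on a half-line.

   Conversely let f be q-plurisubharmonic near the closure of D, with maximum M
   there, and suppose f < M on the closure S of the strictly q-pseudoconvex
   points.  Maximise f(x) + e |x|^2 - k |x - y|^2 over y in the closure of D and
   x close to y; for small e and large k the maximum is attained at an interior
   pair (x, y) with y not in S.  If y is on the boundary, the Levi form of the
   boundary at y is nonpositive on a (q+1)-dimensional complex subspace E of the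
   tangent space: otherwise r + c r^2, for a defining function r and large c,
   would be strictly q-plurisubharmonic at y.  So y + w - (Re Q(w) + t |w|^2) nu
   lies in D for small nonzero w in E, where Re Q is pluriharmonic, nu is a
   transversal direction and t > 0 is arbitrary.  Comparing the maximum with the
   pair made of x + w and this point bounds f on x + E by a pluriharmonic
   function minus a multiple of |w|^2, with equality at w = 0, which contradicts
   subpluriharmonicity.  If y is interior, take nu = 0. *)

(* Closed boundaries of [PSH] are closed boundaries of the smaller class [PSH2], so both equalities
   follow from a cycle of inclusions: the closure of the strict points lies in the Shilov boundary
   of [PSH2], this lies in that of [PSH], and the latter lies in the closure of the strict points.
   Only the last step meets nonsmooth functions, and nothing is smoothed there: subpluriharmonicity
   is tested on small balls against polynomials of degree two. The form of the bending comes from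
   the penalty. Moving x by w and y by w - theta nu changes x - y by theta nu, hence k |x - y|^2 by
   2 k theta (x - y, nu) + k theta^2 |nu|^2. The first term has the same order |w|^2 as the gain e
   |w|^2, has an unknown sign, and k is large and fixed after e. It is harmless because Re Q is
   pluriharmonic and can be moved into the comparison function. What remains of it is a multiple of
   k t |w|^2, small since t may be chosen after k, while the theta^2 term is of order |w|^4. *)
Require Import Defs.
From HB Require Import structures.
From mathcomp Require Import all_boot all_order all_algebra.
From mathcomp Require Import complex.
From mathcomp Require Import all_classical all_reals all_analysis.
From mathcomp Require Import ring lra zify.
Set Implicit Arguments.
Unset Strict Implicit.
Unset Printing Implicit Defensive.
Import Order.TTheory GRing.Theory Num.Theory.
Import numFieldNormedType.Exports.
Local Open Scope classical_set_scope.
Local Open Scope ring_scope.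

(** * Hermitian forms *)

Section HermitianForms.
Local Open Scope sesquilinear_scope.
Variable C : numClosedFieldType.

Definition hform n (H : 'M[C]_n) (u : 'rV[C]_n) : C := (u *m H *m u^t*) 0 0.

Definition csqnorm n (u : 'rV[C]_n) : C := \sum_i `|u 0 i| ^+ 2.

Lemma csqnorm_ge0 n (u : 'rV[C]_n) : 0 <= csqnorm u.
Proof. by apply: sumr_ge0 => i _; rewrite exprn_ge0. Qed.

Lemma csqnorm_gt0 n (u : 'rV[C]_n) : u != 0 -> 0 < csqnorm u.
Proof.
move=> u0; rewrite lt_neqAle csqnorm_ge0 andbT eq_sym; apply: contra u0.
rewrite psumr_eq0 => [/allP h|i _]; last by rewrite exprn_ge0.
apply/eqP/rowP => i; rewrite mxE; apply/eqP.
by have := h i (mem_index_enum _); rewrite implyTb expf_eq0 normr_eq0.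
Qed.

Lemma hformM m n (H : 'M[C]_n) (A : 'M[C]_(m, n)) u :
  hform (A *m H *m A^t*) u = hform H (u *m A).
Proof. by rewrite /hform trmx_mul map_mxM !mulmxA. Qed.

Lemma hform_diag n (d : 'rV[C]_n) u :
  hform (diag_mx d) u = \sum_i d 0 i * `|u 0 i| ^+ 2.
Proof.
rewrite /hform mxE; apply: eq_bigr => i _; rewrite mul_mx_diag !mxE normCK.
ring.
Qed.

Lemma hform1 n u : hform (1%:M : 'M[C]_n) u = csqnorm u.
Proof.
rewrite -diag_const_mx hform_diag; apply: eq_bigr => i _.
by rewrite mxE mul1r.
Qed.

Lemma csqnorm_unitary m n (A : 'M[C]_(m, n)) u : A \is unitarymx ->
  csqnorm (u *m A) = csqnorm u.
Proof.
move=> /unitarymxP hA; rewrite -(hform1 (u *m A)) -hformM mulmx1 hA.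
by rewrite hform1.
Qed.

Lemma char_poly_conj n (P D : 'M[C]_n) : P \in unitmx ->
  char_poly (invmx P *m D *m P) = char_poly D.
Proof.
move=> uP; rewrite /char_poly.
have -> : char_poly_mx (invmx P *m D *m P) =
    map_mx polyC (invmx P) *m char_poly_mx D *m map_mx polyC P.
  rewrite /char_poly_mx mulmxBr mulmxBl !map_mxM scalar_mxC -[_%:M *m _ *m
    _]mulmxA.
  have -> : map_mx polyC (invmx P) *m map_mx polyC P = 1%:M.
    by rewrite -map_mxM mulVmx // map_mx1.
  by rewrite mulmx1.
rewrite !det_mulmx mulrAC -det_mulmx -map_mxM mulVmx //.
by rewrite map_mx1 det1 mul1r.
Qed.

(** The characteristic polynomial is recorded in factored form because [at_least_pos_eigenvalues]
    counts the roots of such a factorisation. *)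
Lemma hermitian_diag n (H : 'M[C]_n) : H = H^t* ->
  exists (P : 'M[C]_n) (d : 'rV[C]_n), [/\ P \is unitarymx,
    forall i, d 0 i \is Num.real, H = P^t* *m diag_mx d *m P &
    char_poly H = \prod_(a <- [seq d 0 i | i <- enum 'I_n]) ('X - a%:P)].
Proof.
move=> hH.
have hH' : H \is hermsymmx by apply/is_hermitianmxP; rewrite expr0 scale1r.
exists (spectralmx H), (spectral_diag H); split.
- exact: spectral_unitarymx.
- by move=> i; have /mxOverP := hermitian_spectral_diag_real hH'.
- rewrite -invmx_unitary ?spectral_unitarymx//.
  exact/orthomx_spectralP/hermitian_normalmx.
have /orthomx_spectralP {1}-> := hermitian_normalmx hH'.
rewrite char_poly_conj ?spectral_unit// char_poly_trig ?diag_mx_is_trig//.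
rewrite big_map big_enum /=; apply: eq_bigr => i _.
by rewrite mxE eqxx.
Qed.

Lemma rowsub_unitary m n (P : 'M[C]_n) (f : 'I_m -> 'I_n) :
  injective f -> P \is unitarymx -> rowsub f P \is unitarymx.
Proof.
move=> fi /row_unitarymxP hP; apply/row_unitarymxP => i j.
by rewrite !row_rowsub hP (inj_eq fi).
Qed.

Lemma hform_rowsub m n (P : 'M[C]_n) (d : 'rV[C]_n) (f : 'I_m -> 'I_n) u :
  injective f -> P \is unitarymx ->
  hform (P^t* *m diag_mx d *m P) (u *m rowsub f P) =
  \sum_i d 0 (f i) * `|u 0 i| ^+ 2.
Proof.
move=> fi hP; rewrite rowsubE mulmxA.
have -> : P^t* *m diag_mx d *m P = P^t* *m diag_mx d *m (P^t*)^t*.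
  by rewrite trmxCK.
rewrite hformM mulmxtVK // -hformM.
transitivity (hform (diag_mx (\row_i d 0 (f i))) u); last first.
  by rewrite hform_diag; apply: eq_bigr => i _; rewrite mxE.
congr (hform _ _); apply/matrixP => i j; rewrite !mxE (bigD1 (f i)) //= big1
  ?addr0.
  rewrite mul_mx_diag !mxE eqxx (inj_eq fi) mul1r eq_sym.
  by case: eqP => [->|]; rewrite ?conjC1 ?conjC0 ?mulr1 ?mulr0.
by move=> k /negbTE hk; rewrite mul_mx_diag !mxE eq_sym hk !mul0r.
Qed.

(** Grassmann's formula: two row spaces of total rank greater than n intersect. *)
Lemma capped_vector m k n (A : 'M[C]_(m, n)) (B : 'M[C]_(k, n)) :
  (n < m + k)%N -> row_free A -> row_free B ->
  exists u : 'rV_m, exists v : 'rV_k, u != 0 /\ u *m A = v *m B.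
Proof.
move=> hmk /eqP rA /eqP rB.
have : (A :&: B)%MS != 0.
  rewrite -mxrank_eq0; have := mxrank_sum_cap A B; rewrite rA rB.
  have := rank_leq_col (A + B)%MS; lia.
move=> /rowV0Pn[w]; rewrite sub_capmx => /andP[/submxP[u wA] /submxP[v wB]] w0.
exists u, v; split; last by rewrite -wA.
by apply: contra w0 => /eqP u0; rewrite wA u0 mul0mx.
Qed.

Lemma unitary_free m n (A : 'M[C]_(m, n)) : A \is unitarymx -> row_free A.
Proof. by move=> /mxrank_unitary rA; rewrite /row_free rA. Qed.

Lemma ordinal_choice n (S : pred 'I_n) m : (m <= #|S|)%N ->
  exists2 f : 'I_m -> 'I_n, injective f & forall i, f i \in S.
Proof.
move=> mS; exists (fun i => enum_val (widen_ord mS i)).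
  by move=> i j /enum_val_inj /(congr1 val) /= /val_inj.
by move=> i; exact: enum_valP.
Qed.

Lemma count_map_ord n (d : 'I_n -> C) (p : pred C) :
  count p [seq d i | i <- enum 'I_n] = #|[pred i | p (d i)]|.
Proof.
by rewrite count_map -sum1_count big_enum_cond sum1_card.
Qed.

(** If fewer than k eigenvalues are positive, at least n + 1 - k are nonpositive, and m of their
    eigenvectors, taken as rows of the diagonalising unitary matrix, form [A]. *)
Lemma pos_eigenvalues_or_nonpos n (H : 'M[C]_n) k m : H = H^t* ->
  (k + m <= n.+1)%N ->
  (exists s : seq C, char_poly H = \prod_(a <- s) ('X - a%:P) /\
      (k <= count (fun a => 0 < a)%R s)%N) \/
  (exists2 A : 'M[C]_(m, n), A \is unitarymx & forall u, hform H (u *m A) <= 0).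
Proof.
move=> /hermitian_diag[P [d [hP dr HE cE]]] hkm.
pose S := [pred i | 0 < d 0 i].
have [hk|hk] := leqP k #|S|.
  left; exists [seq d 0 i | i <- enum 'I_n]; split => //.
  by rewrite count_map_ord.
right; have hm : (m <= #|[predC S]|)%N.
  have E := cardC S; rewrite card_ord in E.
  by rewrite -(leq_add2l #|S|) [X in (_ <= X)%N]E; lia.
have [f fi fS] := ordinal_choice hm.
exists (rowsub f P); first exact: rowsub_unitary.
move=> u; rewrite HE hform_rowsub//; apply: sumr_le0 => i _.
rewrite mulr_le0_ge0 ?exprn_ge0//.
by have := fS i; rewrite !inE /= real_ltNge ?negbK.
Qed.

Lemma pos_eigenvalues_frame n (H : 'M[C]_n) k (s : seq C) : H = H^t* ->
  char_poly H = \prod_(a <- s) ('X - a%:P) ->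
  (k <= count (fun a => 0 < a)%R s)%N ->
  exists (P : 'M[C]_(k, n)) (l : C), [/\ P \is unitarymx, 0 < l &
    forall u, l * csqnorm u <= hform H (u *m P)].
Proof.
move=> /hermitian_diag[P [d [hP dr HE cE]]]; rewrite cE => /prod_XsubC_eq.
move=> /seq.permP <-; rewrite count_map_ord.
move=> /ordinal_choice[f fi fS].
have [l l0 lf] : exists2 l : C, 0 < l & forall i, l <= d 0 (f i).
  (* Starting the minimum at 1 keeps it positive when [k = 0]. *)
  exists (\big[Num.min/1]_i d 0 (f i)).
    elim/big_ind: _ => // [x y x0 y0|i _]; last by have := fS i; rewrite inE.
    by rewrite /Num.min; case: ifP.
  move=> i.
  (* The order of C is partial, so the induction also carries that the minimum is real, hence
     comparable with the next eigenvalue. *)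
  have : forall r : seq 'I_k, (\big[Num.min/1]_(i <- r) d 0 (f i) \is Num.real)
    /\
     (i \in r -> \big[Num.min/1]_(i <- r) d 0 (f i) <= d 0 (f i)).
    elim => [|j r [IHr IH]]; first by rewrite big_nil.
    rewrite big_cons; split; first by rewrite min_real.
    rewrite inE comparable_ge_min ?real_comparable// => /orP[/eqP <-|/IH ->].
      by rewrite lexx.
    by rewrite orbT.
  by move=> /(_ (index_enum _))[_]; apply; rewrite mem_index_enum.
exists (rowsub f P), l; split => //; first exact: rowsub_unitary.
move=> u; rewrite HE hform_rowsub// mulr_sumr; apply: ler_sum => i _.
by rewrite ler_wpM2r ?exprn_ge0.
Qed.

(** Otherwise H would be nonpositive on a subspace of dimension n - k + 1, which meets the
    k-dimensional row space of [B] in a nonzero vector. *)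
Lemma pos_frame_eigenvalues n (H : 'M[C]_n) k (B : 'M[C]_(k, n)) : H = H^t* ->
  (forall u, u != 0 -> 0 < hform H (u *m B)) ->
  exists s : seq C, char_poly H = \prod_(a <- s) ('X - a%:P) /\
      (k <= count (fun a => 0 < a)%R s)%N.
Proof.
move=> hH hB.
have fB : row_free B.
  rewrite -kermx_eq0; apply/rowV0P => u /sub_kermxP uB.
  apply/eqP/negPn/negP => /hB; rewrite uB /hform mul0mx mul0mx mxE.
  by rewrite ltxx.
have kn : (k <= n)%N by rewrite -(eqP fB) rank_leq_col.
have [//|[A uA hA]] := @pos_eigenvalues_or_nonpos n H k (n - k).+1 hH
  ltac:(lia).
have [u [v [u0 uv]]] := @capped_vector _ _ _ A B ltac:(lia) (unitary_free uA)
  fB.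
have [v0|/hB] := eqVneq v 0.
  have := csqnorm_gt0 u0; rewrite -(csqnorm_unitary u uA) uv v0 mul0mx.
  by rewrite /csqnorm big1 ?ltxx// => i _; rewrite mxE normr0 expr0n.
by rewrite -uv => /lt_geF; rewrite hA.
Qed.

Lemma hform_real n (H : 'M[C]_n) u : H = H^t* -> hform H u \is Num.real.
Proof.
move=> hH; rewrite CrealE /hform; apply/eqP.
have /(congr1 (fun X : 'M[C]_1 => X 0 0)) :
    (u *m H *m u^t*)^t* = u *m H *m u^t*.
  by rewrite !trmx_mul !map_mxM trmxCK -hH mulmxA.
by rewrite !mxE.
Qed.

Lemma hformD n (H : 'M[C]_n) u v : H = H^t* ->
  hform H (u + v) =
  hform H u + ((u *m H *m v^t*) 0 0 + ((u *m H *m v^t*) 0 0)^*) + hform H v.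
Proof.
move=> hH.
have -> : ((u *m H *m v^t*) 0 0)^* = (v *m H *m u^t*) 0 0.
  rewrite -[RHS](congr1 (fun X : 'M[C]_1 => X 0 0) (trmxCK _)).
  by rewrite !trmx_mul !map_mxM trmxCK -hH mulmxA !mxE.
by rewrite /hform linearD map_mxD !mulmxDl !mulmxDr !mxE; ring.
Qed.

(* The second alternative says that H + c a a^* is positive definite on a space
   of dimension k + 1, spanned by a positive subspace of ker a and by a^*: for
   large c the cross terms are absorbed by completing squares. *)
Lemma tangent_alternative n (H : 'M[C]_n) (a : 'cV[C]_n) q k : H = H^t* ->
  a != 0 -> (k + 1 + q = n)%N ->
  (exists A : 'M[C]_(q.+1, n), [/\ A \is unitarymx, A *m a = 0 &
     forall u, hform H (u *m A) <= 0]) \/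
  (exists (B : 'M[C]_(k + 1, n)) (c l : C), [/\ c \is Num.real, 0 < l &
     forall u, l * csqnorm u <= hform H (u *m B) + c * `|(u *m B *m a) 0 0| ^+
       2]).
Proof.
move=> hH a0 kqn.
pose K := schmidt (row_base (kermx a)).
have rk : (\rank (kermx a)).+1 = n.
  have rT : \rank a = 1%N.
    apply/eqP; rewrite eqn_leq rank_leq_col lt0n mxrank_eq0 //.
  by rewrite mxrank_ker rT; lia.
have uK : K \is unitarymx by apply: schmidt_unitarymx; rewrite rank_leq_row.
have Ka : K *m a = 0.
  apply/sub_kermxP; rewrite /K eqmx_schmidt_free ?row_base_free//.
  by rewrite eq_row_base.
have hK : K *m H *m K^t* = (K *m H *m K^t*)^t*.
  by rewrite !trmx_mul !map_mxM trmxCK -hH mulmxA.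
have [[s [cs ks]]|[A uA hA]] :=
    @pos_eigenvalues_or_nonpos _ _ k q.+1 hK ltac:(lia); last first.
  left; exists (A *m K); split; first exact: mul_unitarymx.
    by rewrite -mulmxA Ka mulmx0.
  by move=> u; rewrite mulmxA -hformM.
right; have [P [l [uP l0 hP]]] := pos_eigenvalues_frame hK cs ks.
pose z : 'cV_k := P *m K *m H *m a.
pose Z := \sum_i `|z i 0| ^+ 2.
pose h0 := hform H (a^t*).
pose al := csqnorm (a^t*).
have al0 : 0 < al.
  apply: csqnorm_gt0; apply: contra a0 => /eqP /(congr1 (fun X => X^t*)).
  by rewrite trmxCK => ->; rewrite linear0 map_mx0.
have alE : (a^t* *m a) 0 0 = al.
  by rewrite /al -hform1 /hform mulmx1 trmxCK.
(* For u = (p, tau) this c turns the tau part into (1 + 2 Z / l) |tau|^2. Completing the squares of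
   the cross terms uses up l/2 |p|^2 and 2 Z / l |tau|^2. What is left is l/2 |p|^2 + |tau|^2, and l
   / (l + 2) is below both coefficients. *)
exists (col_mx (P *m K) (a^t*)), ((1 + 2 / l * Z - h0) / al ^+ 2),
  (l / (l + 2)).
have lR : l \is Num.real by rewrite gtr0_real.
have Z0 : 0 <= Z by apply: sumr_ge0 => i _; rewrite exprn_ge0.
split; first 1 last.
- by rewrite divr_gt0// addr_gt0.
- move=> u; rewrite -[u]hsubmxK mul_row_col.
  set p := lsubmx u; set t := rsubmx u; pose tau := t 0 0.
  have tE : t *m a^t* = tau *: a^t*.
    apply/rowP => i; rewrite [RHS]mxE mxE big_ord1.
    by rewrite /tau; congr (t _ _ * (a^t* ) _ _); exact/val_inj.
  rewrite hformD // tE [p *m (P *m K)]mulmxA.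
  have -> : hform H (tau *: a^t*) = `|tau| ^+ 2 * h0.
    rewrite /hform linearZ /= map_mxZ -!scalemxAl -scalemxAr.
    by rewrite mxE [X in _ * X]mxE normCK mulrA; congr (_ * _); exact: mulrC.
  have -> : ((p *m P *m K *m H *m (tau *: a^t*)^t*) 0 0) =
            \sum_i p 0 i * (tau * (z i 0)^*)^*.
    rewrite linearZ /= map_mxZ trmxCK -scalemxAr.
    have -> : p *m P *m K *m H *m a = p *m z by rewrite /z !mulmxA.
    rewrite !mxE mulr_sumr; apply: eq_bigr => i _.
    by rewrite rmorphM /= conjCK; ring.
  have -> : ((p *m P *m K + tau *: a^t*) *m a) 0 0 = tau * al.
    by rewrite mulmxDl -mulmxA Ka mulmx0 add0r -scalemxAl mxE alE.
  have -> : csqnorm (row_mx p t) = csqnorm p + `|tau| ^+ 2.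
    rewrite /csqnorm big_split_ord /= big_ord1; congr (_ + _).
      by apply: eq_bigr => i _; rewrite row_mxEl.
    by rewrite row_mxEr.
  have -> : (1 + 2 / l * Z - h0) / al ^+ 2 * `|tau * al| ^+ 2 =
     (1 + 2 / l * Z - h0) * `|tau| ^+ 2.
    rewrite normrM (gtr0_norm al0) exprMn; field.
    by rewrite !gt_eqF.
  apply: le_trans (_ : l / 2 * csqnorm p + `|tau| ^+ 2 <= _).
    rewrite mulrDr; apply: lerD.
      apply: ler_wpM2r; first exact: csqnorm_ge0.
      apply: ler_wpM2l; first exact: ltW.
      by rewrite lef_pV2 ?posrE ?addr_gt0// lerDr ltW.
    rewrite ler_piMl ?exprn_ge0// ler_pdivrMr ?addr_gt0// mul1r.
    by rewrite lerDl.
  rewrite -subr_ge0.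
  set S := \sum_i _.
  have -> : hform H (p *m P *m K) + (S + S^*) + `|tau| ^+ 2 * h0
      + (1 + 2 / l * Z - h0) * `|tau| ^+ 2 - (l / 2 * csqnorm p + `|tau| ^+ 2)
      = (hform H (p *m P *m K) - l * csqnorm p) +
        \sum_i l / 2 * `|p 0 i + 2 / l * (tau * (z i 0)^*)| ^+ 2.
    rewrite [in RHS](eq_bigr (fun i => l / 2 * `|p 0 i| ^+ 2 +
       (p 0 i * (tau * (z i 0)^*)^* + (p 0 i * (tau * (z i 0)^*)^*)^*) +
       2 / l * (`|tau| ^+ 2 * `|z i 0| ^+ 2))); last first.
      move=> i _; rewrite !normCK !rmorphD !rmorphM /= fmorphV /= (CrealP lR).
      rewrite !conjCK conjC_nat; field.
      by rewrite gt_eqF.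
    rewrite !big_split /= -!mulr_sumr -/(csqnorm _) -/Z -/S -rmorph_sum -/S.
    field. by rewrite gt_eqF.
  apply: addr_ge0; first by rewrite subr_ge0 -hformM.
  by apply: sumr_ge0 => i _; rewrite mulr_ge0 ?exprn_ge0// divr_ge0// ltW.
- have hR : h0 \is Num.real by exact: hform_real.
  have alR : al \is Num.real by rewrite gtr0_real.
  have ZR : Z \is Num.real by rewrite ger0_real.
  by rewrite rpred_div ?rpredX// rpredB// rpredD ?rpred1// rpredM// rpred_div//
    rpred_nat.
Qed.

End HermitianForms.

(** * Directional derivatives *)

Section DirectionalDerivatives.
Variables (R : realType) (V : normedModType R).
Implicit Types (h : V -> R) (y z v w : V).

Lemma is_derive_line h z v t : derivable h (t *: v + z) v ->
  is_derive t 1 (fun s : R => h (s *: v + z)) ('D_v h (t *: v + z)).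
Proof.
move=> hd.
have E : (fun e : R => e^-1 *: (((fun s : R =>
  h (s *: v + z)) \o shift t) (e *: 1) -
     h (t *: v + z))) =
   (fun e => e^-1 *: ((h \o shift (t *: v + z)) (e *: v) - h (t *: v + z))).
  apply/funext => e /=; congr (_ *: (h _ - _)).
  by rewrite [_%:A]mulr1 scalerDl addrA.
by split; rewrite ?/derivable ?/derive E.
Qed.

Lemma derive_of_line h z v (d : R) :
  is_derive (0 : R) 1 (fun s : R => h (s *: v + z)) d -> is_derive z v h d.
Proof.
move=> [hd hE]; have hz : derivable h z v by exact/derivable1P.
split=> //.
have := @is_derive_line h z v 0; rewrite scale0r add0r => /(_ hz) [_ <-].
exact: hE.
Qed.

Lemma is_deriveZdir h z v (a d : R) : is_derive z v h d ->
  is_derive z (a *: v) h (a * d).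
Proof.
move=> [hd hE]; apply: derive_of_line.
have E : (fun s : R => h (s *: (a *: v) + z)) =
   (fun s => h (s *: v + z)) \o (fun s => s * a).
  by apply/funext => s /=; rewrite scalerA.
rewrite E mulrC -hE.
have L0 : is_derive (0 * a) 1 (fun s : R => h (s *: v + z)) ('D_v h z).
  have := @is_derive_line h z v 0; rewrite mul0r scale0r add0r; exact.
have L1 : is_derive (0:R) 1 (fun s : R => s * a) a.
  have -> : (fun s : R => s * a) = a \*: id.
    by apply/funext => s /=; rewrite /GRing.scale/= mulrC.
  by apply: is_derive_eq; rewrite scaler1.
exact: (@is_derive1_comp R (fun s => h (s *: v + z)) (fun s => s * a) 0
  _ _ L0 L1).
Qed.

Lemma deriveZdir h z v a : derivable h z v ->
  'D_(a *: v) h z = a * 'D_v h z.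
Proof. by move=> /derivableP /(is_deriveZdir a) []. Qed.

Lemma MVT_line h z v :
  (forall t, 0 <= t <= 1 -> derivable h (t *: v + z) v) ->
  exists2 c : R, 0 < c < 1 & h (v + z) - h z = 'D_v h (c *: v + z).
Proof.
move=> hd.
have [||c c01 E] := @MVT R (fun s : R => h (s *: v + z))
   (fun s => 'D_v h (s *: v + z)) 0 1 ltr01.
- move=> t; rewrite in_itv /= => /andP[t0 t1]; apply: is_derive_line; apply: hd.
  by rewrite !ltW.
- apply: derivable_within_continuous => t; rewrite in_itv /= => t01.
  by have [] := @is_derive_line h z v t (hd _ t01).
exists c; first by move: c01; rewrite in_itv.
by move: E; rewrite scale1r scale0r add0r subr0 mulr1.
Qed.

(** C^1 smoothness in the directional form of [C2_on]: linearity of ['D_v h] in [v] is not built in,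
    it is the content of [deriveDdir]. *)
Definition C1_near h z := \forall y \near z, forall v,
  derivable h y v /\ {for y, continuous ('D_v h)}.

Lemma C1_nearP h z : C1_near h z -> exists2 e : R, 0 < e &
  forall y, `|y - z| < e -> forall v,
  derivable h y v /\ {for y, continuous ('D_v h)}.
Proof.
move=> /nbhs_ballP[e /= e0 he]; exists e => // y yz v; apply: he.
by rewrite -ball_normE /= distrC.
Qed.

Lemma continuous_dist (f : V -> R) z : {for z, continuous f} ->
  forall e : R, 0 < e -> exists2 d : R, 0 < d &
    forall y, `|y - z| < d -> `|f y - f z| < e.
Proof.
move=> /cvgrPdist_lt fc e e0; have /nbhs_ballP[d /= d0 hd] := fc e e0.
exists d => // y yz; rewrite distrC; apply: hd.
by rewrite -ball_normE /= distrC.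
Qed.

(** The difference quotient along v + w is the quotient along v at z plus a quotient along w at the
    moving point z + t v. The mean value theorem turns the latter into a value of ['D_w h] near z,
    and continuity gives the limit. *)
Lemma deriveDdir h z v w : C1_near h z ->
  'D_(v + w) h z = 'D_v h z + 'D_w h z.
Proof.
move=> hC; have [e e0 he] := C1_nearP hC.
have zz : `|z - z| < e by rewrite subrr normr0.
have [dvw _] := he z zz (v + w).
have [dv _] := he z zz v.
have [dw cw] := he z zz w.
rewrite {1}/derive; apply: cvg_lim; first exact: Rhausdorff.
have E : (fun t : R => t^-1 *: ((h \o shift z) (t *: (v + w)) - h z)) =
   (fun t => t^-1 *: ((h \o shift z) (t *: v) - h z)) \+
   (fun t => t^-1 *: ((h \o shift (t *: v + z)) (t *: w) - h (t *: v + z))).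
  apply/funext => t /=; rewrite -[RHS]scalerDr; congr (_ *: _).
  have -> : t *: (v + w) + z = t *: w + (t *: v + z).
    by rewrite scalerDr [t *: v + t *: w]addrC -addrA.
  ring.
rewrite E; apply: cvgD; first exact: dv.
apply/cvgrPdist_lt => eps eps0.
have [d d0 hd] := continuous_dist cw eps0.
pose M := `|v| + `|w| + 1.
have M0 : 0 < M by rewrite /M ltr_wpDl// addr_ge0.
have md0 : 0 < Num.min d e by rewrite lt_min d0 e0.
have : \forall t \near (0:R)^', `|t| < Num.min d e / M.
  apply: dnbhs0_lt; rewrite divr_gt0//.
move=> H.
have Hn : \forall t \near (0:R)^', t != 0 by exact: nbhs_dnbhs_neq.
near=> t.
have t0 : t != 0 by near: t.
have tM : `|t| * M < Num.min d e by rewrite -ltr_pdivlMr//; near: t.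
have small c : 0 <= c <= 1 -> `|c *: (t *: w) + (t *: v + z) - z| < Num.min d e.
  move=> /andP[c0 c1]; rewrite addrA addrK; apply: le_lt_trans tM.
  apply: le_trans (ler_normD _ _) _; rewrite !normrZ (ger0_norm c0) /M.
  have := mulr_ge0 (normr_ge0 t) (normr_ge0 w).
  have := mulr_ge0 (normr_ge0 t) (normr_ge0 v).
  have := normr_ge0 t.
  nra.
have [c /andP[c0 c1] Ec] : exists2 c : R, 0 < c < 1 &
    h (t *: w + (t *: v + z)) - h (t *: v + z) =
     'D_(t *: w) h (c *: (t *: w) + (t *: v + z)).
  apply: MVT_line => c c01; have := small c c01; rewrite lt_min => /andP[_].
  by move=> /he /(_ (t *: w)) [].
have := small c; rewrite !ltW// => /(_ isT); rewrite lt_min => /andP[s1 s2].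
rewrite /= Ec deriveZdir; last by have [] := he _ s2 w.
rewrite [_ *: _]mulrA mulVf// mul1r distrC; exact: hd.
Unshelve. all: by end_near. Qed.

End DirectionalDerivatives.

(** * Euclidean structure of C^N *)

Section Coordinates.
Variables (R : realType) (N : nat).
Implicit Types (v w z : Cn R N).

Definition rbasis (i : 'I_N + 'I_N) : Cn R N :=
  match i with inl j => dirx R j | inr j => diry R j end.

Definition rcoord w (i : 'I_N + 'I_N) : R :=
  match i with inl j => w.1 ord0 j | inr j => w.2 ord0 j end.

(** The Euclidean norm, unlike the library norm, is invariant under multiplication by i and under
    unitary embeddings. *)
Definition sqnorm w : R := \sum_i rcoord w i ^+ 2.

Definition rdot v w : R := \sum_i rcoord v i * rcoord w i.

Lemma rcoordD v w i : rcoord (v + w) i = rcoord v i + rcoord w i.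
Proof. by case: i => j; rewrite /rcoord/= mxE. Qed.

Lemma rcoordZ (a : R) w i : rcoord (a *: w) i = a * rcoord w i.
Proof. by case: i => j; rewrite /rcoord/= mxE. Qed.

Lemma rcoordN w i : rcoord (- w) i = - rcoord w i.
Proof. by case: i => j; rewrite /rcoord/= mxE. Qed.

Lemma rcoord_inj v w : (forall i, rcoord v i = rcoord w i) -> v = w.
Proof.
case: v w => [v1 v2] [w1 w2] h; congr pair.
all: apply/rowP => j; rewrite ?(ord1 ord0).
  exact: (h (inl j)).
exact: (h (inr j)).
Qed.

Lemma rcoord_sum (I : Type) (r : seq I) (F : I -> Cn R N) i :
  rcoord (\sum_(j <- r) F j) i = \sum_(j <- r) rcoord (F j) i.
Proof.
elim/big_ind2 : _ => [|a b c d <- <-|//]; last by rewrite rcoordD.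
by case: i => j; rewrite /rcoord/= mxE.
Qed.

Lemma rcoord_rbasis i j : rcoord (rbasis i) j = (i == j)%:R.
Proof.
by case: i => i; case: j => j; rewrite /rcoord/= ?mxE ?eqxx/= ?[j == i]eq_sym.
Qed.

Lemma sum_rbasis w : w = \sum_i rcoord w i *: rbasis i.
Proof.
apply: rcoord_inj => i; rewrite rcoord_sum (bigD1 i) //= rcoordZ rcoord_rbasis
  eqxx mulr1.
by rewrite big1 ?addr0// => j /negbTE hj; rewrite rcoordZ rcoord_rbasis hj
  mulr0.
Qed.

Lemma sqnormE w : sqnorm w = \sum_j (w.1 ord0 j ^+ 2 + w.2 ord0 j ^+ 2).
Proof. by rewrite /sqnorm big_sumType /= big_split. Qed.

Lemma sqnorm_ge0 w : 0 <= sqnorm w.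
Proof. by apply: sumr_ge0 => i _; rewrite sqr_ge0. Qed.

Lemma sqnorm0 : sqnorm 0 = 0.
Proof. by rewrite /sqnorm big1// => -[] i _; rewrite /rcoord/= mxE expr0n. Qed.

Lemma rcoord_sqnorm w i : rcoord w i ^+ 2 <= sqnorm w.
Proof. by rewrite /sqnorm (bigD1 i) //= lerDl sumr_ge0// => j _;
  rewrite sqr_ge0. Qed.

Lemma sqnorm_eq0 w : sqnorm w <= 0 -> w = 0.
Proof.
move=> h; apply: rcoord_inj => i; have := le_trans (rcoord_sqnorm w i) h.
have -> : rcoord 0 i = 0 by case: i => j; rewrite /rcoord/= mxE.
nra.
Qed.

Lemma sqnormZ (a : R) w : sqnorm (a *: w) = a ^+ 2 * sqnorm w.
Proof. by rewrite /sqnorm mulr_sumr; apply: eq_bigr => i _;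
  rewrite rcoordZ exprMn. Qed.

Lemma sqnormN w : sqnorm (- w) = sqnorm w.
Proof. by apply: eq_bigr => i _; rewrite rcoordN sqrrN. Qed.

Lemma sqnormD v w : sqnorm (v + w) = sqnorm v + 2 * rdot v w + sqnorm w.
Proof.
rewrite /sqnorm /rdot mulr_sumr -!big_split /=; apply: eq_bigr => i _.
by rewrite rcoordD; ring.
Qed.

Lemma sqnormD_le v w : sqnorm (v + w) <= 2 * sqnorm v + 2 * sqnorm w.
Proof.
rewrite /sqnorm !mulr_sumr -big_split; apply: ler_sum => i _ /=.
by rewrite rcoordD; have := sqr_ge0 (rcoord v i - rcoord w i); nra.
Qed.

Lemma eballE (c z : Cn R N) r : eball c r z <-> sqnorm (z - c) < r ^+ 2.
Proof.
rewrite /eball /= sqnormE.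
suff -> : \sum_j ((z - c).1 ord0 j ^+ 2 + (z - c).2 ord0 j ^+ 2) =
  \sum_j ((z.1 ord0 j - c.1 ord0 j) ^+ 2 + (z.2 ord0 j - c.2 ord0 j) ^+ 2)
    by [].
by apply: eq_bigr => j _; rewrite !mxE.
Qed.

Definition lin_fun (l : Cn R N -> R) :=
  (forall v w, l (v + w) = l v + l w) /\ (forall a v, l (a *: v) = a * l v).

Lemma lin_fun_sum l w : lin_fun l -> l w = \sum_i rcoord w i * l (rbasis i).
Proof.
move=> [lD lZ]; rewrite {1}[w]sum_rbasis.
have l0 : l 0 = 0 by rewrite -(scale0r 0) lZ mul0r.
elim: (index_enum _) => [|i r IH]; first by rewrite !big_nil.
by rewrite !big_cons lD lZ IH.
Qed.

Lemma continuous_rcoord i : continuous (fun w => rcoord w i).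
Proof.
case: i => j w; rewrite /rcoord.
  apply: (@continuous_comp _ _ _ fst (fun x : 'rV[R]_N => x ord0 j)).
    exact: cvg_fst.
  exact: coord_continuous.
apply: (@continuous_comp _ _ _ snd (fun x : 'rV[R]_N => x ord0 j)).
  exact: cvg_snd.
exact: coord_continuous.
Qed.

Lemma continuous_sum (F : 'I_N + 'I_N -> Cn R N -> R) z :
  (forall i, {for z, continuous (F i)}) ->
  {for z, continuous (fun w => \sum_i F i w)}.
Proof.
move=> h; apply: cvg_big => [|i _]; last exact: h.
by move=> x; exact: add_continuous.
Qed.

Lemma continuous_lin l : lin_fun l -> continuous l.
Proof.
move=> hl w; have -> : l = fun w => \sum_i rcoord w i * l (rbasis i).
  by apply/funext => u; exact: lin_fun_sum.
apply: continuous_sum => i; apply: cvgM; last exact: cvg_cst.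
exact: continuous_rcoord.
Qed.

Lemma continuous_sqnorm : continuous sqnorm.
Proof.
move=> w; apply: continuous_sum => i.
by apply: cvgM; exact: continuous_rcoord.
Qed.

Lemma norm_le_rcoord w (e : R) : 0 <= e -> (forall i, `|rcoord w i| <= e) ->
  `|w| <= e.
Proof.
move=> e0 h; rewrite prod_normE ge_max; apply/andP; split.
  rewrite /Num.norm/= mx_normrE; apply: bigmax_le => // -[i j] _ /=.
  by have := h (inl j); rewrite /rcoord/= (ord1 i).
rewrite /Num.norm/= mx_normrE; apply: bigmax_le => // -[i j] _ /=.
by have := h (inr j); rewrite /rcoord/= (ord1 i).
Qed.

Lemma norm_le_sqnorm w (e : R) : 0 <= e -> sqnorm w <= e ^+ 2 -> `|w| <= e.
Proof.
move=> e0 he; apply: norm_le_rcoord => // i.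
by rewrite -ler_sqr ?nnegrE// real_normK ?num_real//;
  exact: le_trans (rcoord_sqnorm w i) he.
Qed.

(** The radius bounds the squared norm, so that no square roots occur later. *)
Lemma nbhs_sqnormP z (A : set (Cn R N)) :
  nbhs z A <-> exists2 r : R, 0 < r & forall y : Cn R N,
    sqnorm (y - z) <= r -> A y.
Proof.
split=> [/nbhs_ballP[e /= e0 he]|[r r0 hr]].
  exists ((e / 2) ^+ 2); first by rewrite exprn_gt0 ?divr_gt0.
  move=> y hy; apply: he; rewrite -ball_normE /= distrC.
  have := norm_le_sqnorm _ hy; rewrite ltW ?divr_gt0// => /(_ isT).
  lra.
have c : {for z, continuous (fun y : Cn R N => sqnorm (y - z))}.
  apply: continuous_comp; last exact: continuous_sqnorm.
  by apply: cvgB; [exact: cvg_id|exact: cvg_cst].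
have H : \forall y \near z, sqnorm (y - z) < r.
  by apply: (c [set x | x < r]); rewrite subrr sqnorm0; exact: lt_nbhsl.
by apply: filterS H => y /ltW; exact: hr.
Qed.

Lemma near0_sqnormP (A : set (Cn R N)) :
  nbhs (0 : Cn R N) A <-> exists2 r : R, 0 < r &
    forall y : Cn R N, sqnorm y <= r -> A y.
Proof.
rewrite nbhs_sqnormP; split=> -[r r0 hr]; exists r => // y;
  last by rewrite subr0; exact: hr.
by move=> yr; apply: hr; rewrite subr0.
Qed.

End Coordinates.

(** * Second derivatives *)

Section SecondOrder.
Variables (R : realType) (N : nat).
Implicit Types (U : set (Cn R N)) (h : Cn R N -> R) (v w y z : Cn R N).

Definition derive2 h z v w : R := 'D_w ('D_v h) z.

Definition mulI v : Cn R N := (- v.2, v.1).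

(* Four times the Levi form. *)
Definition levi4 h z v : R := derive2 h z v v + derive2 h z (mulI v) (mulI v).

Lemma continuous_near (f : Cn R N -> R) z (e : R) : {for z, continuous f} ->
  0 < e -> \forall y \near z, `|f y - f z| <= e.
Proof.
by move=> /cvgrPdist_le fc /fc; apply: filterS => y; rewrite distrC.
Qed.

Lemma C2_C1_near U h z : open U -> C2_on U h -> U z -> C1_near h z.
Proof.
move=> oU hC zU; near=> y => v.
have yU : U y by near: y; exact: open_nbhs_nbhs.
by have [_ /(_ v) []] := hC y yU.
Unshelve. all: by end_near. Qed.

Lemma C2_C1_near_derive U h z v : open U -> C2_on U h -> U z ->
  C1_near ('D_v h) z.
Proof.
move=> oU hC zU; near=> y => w.
have yU : U y by near: y; exact: open_nbhs_nbhs.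
by have [_ _ /(_ v w) []] := hC y yU.
Unshelve. all: by end_near. Qed.

Lemma C1_near_lin h z : C1_near h z -> lin_fun (fun v => 'D_v h z).
Proof.
move=> hC; split=> [v w|a v]; first exact: deriveDdir.
by apply: deriveZdir; have [] := nbhs_singleton hC v.
Qed.

Lemma derive2_linr U h z v : open U -> C2_on U h -> U z ->
  lin_fun (derive2 h z v).
Proof. by move=> oU hC zU; apply: C1_near_lin; exact: C2_C1_near_derive zU. Qed.

Lemma derive2_linl U h z w : open U -> C2_on U h -> U z ->
  lin_fun (fun v => derive2 h z v w).
Proof.
move=> oU hC zU; have nU : \forall y \near z, U y by exact: open_nbhs_nbhs.
split=> [v v'|a v]; rewrite /derive2.
  rewrite -deriveD; last 2 first.
  - by have [_ _ /(_ v w) []] := hC z zU.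
  - by have [_ _ /(_ v' w) []] := hC z zU.
  apply: near_eq_derive; apply: filterS nU => y yU.
  by rewrite (deriveDdir _ _ (C2_C1_near oU hC yU)).
rewrite -[RHS]deriveZ; last by have [_ _ /(_ v w) []] := hC z zU.
apply: near_eq_derive; apply: filterS nU => y yU.
by rewrite deriveZdir//; have [_ /(_ v) []] := hC y yU.
Qed.

(** Schwarz's theorem: the second difference of h over the parallelogram spanned by t v and t w does
    not depend on the order of the two directions, and it equals t^2 times either mixed derivative
    at some point near z. *)
Lemma derive2_sym U h z v w : open U -> C2_on U h -> U z ->
  derive2 h z v w = derive2 h z w v.
Proof.
move=> oU hC zU; apply/eqP; rewrite -subr_eq0 -normr_le0.
apply/ler_addgt0Pr => e e0; rewrite add0r.
have aux (X X' Y Z : R) : X = X' -> `|X - Z| < e / 2 -> `|X' - Y| < e / 2 ->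
    `|Z - Y| <= e.
  by rewrite !ltr_norml !ler_norml => <- /andP[? ?] /andP[? ?]; apply/andP;
    split; lra.
have [_ _ Hz] := hC z zU.
have e20 : 0 < e / 2 by rewrite divr_gt0.
have [d1 d10 hd1] := continuous_dist (Hz v w).2 e20.
have [d2 d20 hd2] := continuous_dist (Hz w v).2 e20.
have /nbhs_ballP[d3 /= d30 hd3] : nbhs z U by exact: open_nbhs_nbhs.
pose d := Num.min d1 (Num.min d2 d3).
have d0 : 0 < d by rewrite /d !lt_min d10 d20.
pose M := `|v| + `|w| + 1.
have M0 : 0 < M by rewrite /M ltr_wpDl// addr_ge0.
have [t t0 tM] : exists2 t : R, 0 < t & t * M < d.
  exists (d / (2 * M)); first by rewrite divr_gt0// mulr_gt0.
  rewrite invfM mulrA mulfVK ?gt_eqF//; lra.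
have small (a b : R) : 0 <= a <= 1 -> 0 <= b <= 1 ->
    `|a *: (t *: v) + b *: (t *: w) + z - z| < d.
  move=> /andP[a0 a1] /andP[b0 b1]; rewrite addrK; apply: le_lt_trans tM.
  apply: le_trans (ler_normD _ _) _; rewrite !normrZ (ger0_norm a0) (ger0_norm
    b0).
  rewrite (gtr0_norm t0) /M.
  have := mulr_ge0 (ltW t0) (normr_ge0 w).
  have := mulr_ge0 (ltW t0) (normr_ge0 v).
  nra.
have inU y : `|y - z| < d -> U y.
  rewrite !lt_min => /and3P[_ _ yz]; apply: hd3.
  by rewrite -ball_normE /= distrC.
(* Two applications of the mean value theorem to the second difference. *)
have key (v' w' : Cn R N) :
    (forall a b : R, 0 <= a <= 1 -> 0 <= b <= 1 ->
      `|a *: v' + b *: w' + z - z| < d) ->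
    exists a b : R, [/\ 0 <= a <= 1, 0 <= b <= 1 &
    h (v' + (w' + z)) - h (v' + z) - (h (w' + z) - h z) =
    derive2 h (a *: v' + b *: w' + z) v' w'].
  move=> sm.
  have [a a01 Ea] : exists2 a : R, 0 < a < 1 &
    h (v' + (w' + z)) - h (v' + z) - (h (w' + z) - h z) =
    'D_v' h (a *: v' + (w' + z)) - 'D_v' h (a *: v' + z).
    pose phi (s : R) := h (s *: v' + (w' + z)) - h (s *: v' + z).
    have dphi (s : R) : 0 <= s <= 1 -> is_derive s 1 phi
       ('D_v' h (s *: v' + (w' + z)) - 'D_v' h (s *: v' + z)).
      move=> s01; apply: is_deriveB; apply: is_derive_line.
        have := sm s 1 s01; rewrite lexx ler01 => /(_ isT) /inU yU.
        by rewrite addrA -[w']scale1r; have [_ /(_ v') []] := hC _ yU.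
      have := sm s 0 s01; rewrite lexx ler01 => /(_ isT) /inU yU.
      by move: yU; rewrite scale0r addr0 => yU; have [_ /(_ v') []] := hC _ yU.
    have [||a a01] := @MVT R phi (fun s => 'D_v' h (s *:
      v' + (w' + z)) - 'D_v' h (s *: v' + z)) 0 1 ltr01.
    - by move=> s; rewrite in_itv /= => /andP[s0 s1]; apply: dphi; rewrite !ltW.
    - by apply: derivable_within_continuous => s; rewrite in_itv /= => /dphi [].
    rewrite /phi !scale1r !scale0r !add0r subr0 mulr1 => Ea.
    by exists a => //; move: a01; rewrite in_itv.
  have a01w : 0 <= a <= 1 by case/andP: a01 => *; rewrite !ltW.
  have [|b b01 Eb] := @MVT_line _ _ ('D_v' h) (a *: v' + z) w'.
    move=> b b01; have /inU yU := sm a b a01w b01.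
    rewrite addrCA addrA; by have [_ _ /(_ v' w') []] := hC _ yU.
  exists a, b; split; [exact: a01w|by case/andP: b01 => *; rewrite !ltW|].
  have Ew : a *: v' + (w' + z) = w' + (a *: v' + z) by rewrite addrCA.
  have Ez : b *: w' + (a *: v' + z) = a *: v' + b *: w' + z
    by rewrite addrCA addrA.
  by rewrite Ew in Ea; rewrite Ez in Eb; exact: etrans Ea Eb.
have [a [b [a01 b01 E1]]] := key (t *: v) (t *: w) small.
have [b' [a' [b01' a01' E2]]] := key (t *: w) (t *: v)
  ltac:(by move=> x y x01 y01; rewrite [x *: _ + _]addrC; exact: small).
have D2Z y x x' : U y -> derive2 h y (t *: x) (t *:
  x') = t ^+ 2 * derive2 h y x x'.
  move=> yU; rewrite (derive2_linl _ oU hC yU).2 (derive2_linr _ oU hC yU).2;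
    ring.
have s1 := small _ _ a01 b01.
have s2 := small _ _ a01' b01'.
rewrite D2Z in E1; last exact: inU.
rewrite D2Z in E2; last by rewrite [b' *: _ + _]addrC; exact: inU.
have /(mulfI (lt0r_neq0 (exprn_gt0 2 t0))) E : t ^+ 2 * derive2 h (a *: (t *:
  v) + b *: (t *: w) + z) v w =
  t ^+ 2 * derive2 h (b' *: (t *: w) + a' *: (t *: v) + z) w v.
  apply: etrans (esym E1) _; apply: etrans _ E2;
    rewrite [t *: w + (t *: v + z)]addrCA.
  move: (h (t *: v + (t *: w + z))) (h (t *: v + z)) (h (t *: w + z)) (h z).
  by move=> A B C D; ring.
pose p := a *: (t *: v) + b *: (t *: w) + z.
pose p' := b' *: (t *: w) + a' *: (t *: v) + z.
have p'E : a' *: (t *: v) + b' *: (t *: w) + z = p'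
  by rewrite [a' *: _ + _]addrC.
rewrite -/p -/p' in E s1.
rewrite p'E in s2; move: s1 s2; rewrite !lt_min =>
  /andP[/hd1 X1 _] /and3P[_ /hd2 X2 _].
have {}X1 : `|derive2 h p v w - derive2 h z v w| < e / 2 := X1.
have {}X2 : `|derive2 h p' w v - derive2 h z w v| < e / 2 := X2.
exact: aux E X1 X2.
Qed.

Lemma quad_sum (b : Cn R N -> Cn R N -> R) v w :
  (forall u, lin_fun (b u)) -> (forall u, lin_fun (b^~ u)) ->
  b v w = \sum_i \sum_j rcoord v i * rcoord w j * b (rbasis R i) (rbasis R j).
Proof.
move=> br bl; rewrite (lin_fun_sum v (bl w)); apply: eq_bigr => i _.
by rewrite (lin_fun_sum w (br _)) mulr_sumr; apply: eq_bigr => j _;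
  rewrite mulrA.
Qed.

Lemma quad_small (c : 'I_N + 'I_N -> 'I_N + 'I_N -> R) (k : R) v :
  (forall i j, `|c i j| <= k) ->
  `|\sum_i \sum_j rcoord v i * rcoord v j * c i j| <= k * (N + N)%:R * sqnorm v.
Proof.
move=> ck.
have k_ge (i : 'I_N + 'I_N) : 0 <= k by apply: le_trans (ck i i).
have aux (x y p : R) : 0 <= x -> 0 <= y -> p <= k -> 0 <= k ->
    x * y * p <= k / 2 * x ^+ 2 + k / 2 * y ^+ 2.
  clear k_ge ck; move=> x0 y0 pk k0.
  have : x * y * p <= x * y * k by rewrite ler_wpM2l// mulr_ge0.
  have : 0 <= k * (x - y) ^+ 2 by rewrite mulr_ge0// sqr_ge0.
  lra.
apply: le_trans (_ : \sum_i \sum_j (k / 2 * rcoord v i ^+ 2 + k / 2 * rcoord v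
  j ^+ 2) <= _).
  apply: le_trans (ler_norm_sum _ _ _) _; apply: ler_sum => i _.
  apply: le_trans (ler_norm_sum _ _ _) _; apply: ler_sum => j _.
  rewrite !normrM -(real_normK (num_real (rcoord v i))) -(real_normK (num_real
    (rcoord v j))).
  by apply: aux => //; exact: k_ge.
rewrite (eq_bigr (fun i => k / 2 * rcoord v i ^+ 2 * (N + N)%:R + k / 2 *
  sqnorm v)); last first.
  move=> i _; rewrite big_split /= sumr_const card_sum !card_ord -mulr_sumr.
  by rewrite -[_ *+ (N + N)]mulr_natr.
rewrite big_split /= sumr_const card_sum !card_ord -mulr_suml -mulr_sumr -[_ *+
  (N + N)]mulr_natr.
rewrite -/(sqnorm v) le_eqVlt; apply/orP; left; apply/eqP; by field.
Qed.

Lemma derive2_near U h z (k : R) : open U -> C2_on U h -> U z -> 0 < k ->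
  \forall y \near z, forall v, `|derive2 h y v v - derive2 h z v v| <= k *
    sqnorm v.
Proof.
(* There are 2N real coordinates; the successor keeps the divisor nonzero when [N = 0]. *)
move=> oU hC zU k0; pose k' := k / (N + N).+1%:R.
have k'0 : 0 < k' by rewrite divr_gt0.
have nU : \forall y \near z, U y by exact: open_nbhs_nbhs.
have Hij i j : \forall y \near z,
   `|derive2 h y (rbasis R i) (rbasis R j) - derive2 h z (rbasis R i) (rbasis R
     j)| <= k'.
  by have [_ _ Hz] := hC z zU; exact: (continuous_near (Hz (rbasis R i) (rbasis
    R j)).2 k'0).
have H : \forall y \near z, forall i j,
   `|derive2 h y (rbasis R i) (rbasis R j) - derive2 h z (rbasis R i) (rbasis R
     j)| <= k'.
  pose F i j (y : Cn R N) : Prop :=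
    `|derive2 h y (rbasis R i) (rbasis R j) - derive2 h z (rbasis R i) (rbasis
      R j)| <= k'.
  have Hi i : nbhs z (fun y => forall j, F i j y).
    by apply: (@filter_forall _ _ (F i) (nbhs z) _) => j; exact: Hij.
  exact: (@filter_forall _ _ (fun i y => forall j, F i j y) (nbhs z) _ Hi).
apply: filterS2 nU H => y yU H v.
rewrite (quad_sum v v (fun u => derive2_linr u oU hC yU) (fun u =>
  derive2_linl u oU hC yU)).
rewrite (quad_sum v v (fun u => derive2_linr u oU hC zU) (fun u =>
  derive2_linl u oU hC zU)).
rewrite -sumrB (eq_bigr (fun i => \sum_j rcoord v i * rcoord v j *
   (derive2 h y (rbasis R i) (rbasis R j) - derive2 h z (rbasis R i) (rbasis R
     j)))); last first.
  by move=> i _; rewrite -sumrB; apply: eq_bigr => j _; rewrite mulrBr.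
apply: le_trans (quad_small _ H) _; rewrite ler_wpM2r ?sqnorm_ge0//.
rewrite /k' mulrAC ler_pdivrMr//; apply: ler_wpM2l; first exact: ltW.
by rewrite ler_nat leqnSn.
Qed.

(** The mean value theorem is applied to h along the segment minus its quadratic part, then to
    ['D_v h]. The remainder becomes a difference of second derivatives at two nearby points, which
    [derive2_near] controls. *)
Lemma taylor2 U h z (k : R) : open U -> C2_on U h -> U z -> 0 < k ->
  \forall v \near (0 : Cn R N),
   `|h (z + v) - h z - 'D_v h z - derive2 h z v v / 2| <= k * sqnorm v.
Proof.
move=> oU hC zU k0.
have /nbhs_ballP[d /= d0 hd] : nbhs z [set y | U y /\ forall v,
  `|derive2 h y v v - derive2 h z v v| <= k * sqnorm v].
  have nU : nbhs z U by exact: open_nbhs_nbhs.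
  by apply: filterS2 nU (derive2_near oU hC zU k0) => y yU yD; split.
apply/nbhs_ballP; exists d => //= v; rewrite -ball_normE /= sub0r normrN => vd.
have inb (t : R) : 0 <= t <= 1 -> U (t *: v + z) /\
    forall w, `|derive2 h (t *: v + z) w w - derive2 h z w w| <= k * sqnorm w.
  move=> /andP[t0 t1]; apply: hd; rewrite -ball_normE /= opprD addrCA subrr
    addr0.
  by rewrite normrN normrZ ger0_norm//; apply: le_lt_trans vd; rewrite ler_piMl.
have dz : derivable h z v by have [_ /(_ v) []] := hC z zU.
pose psi (t : R) := h (t *: v + z) - (t * 'D_v h z + t ^+ 2 * (derive2 h z v v
  / 2)).
have dpsi (t : R) : 0 <= t <= 1 -> is_derive t 1 psi
    ('D_v h (t *: v + z) - ('D_v h z + t * derive2 h z v v)).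
  move=> /inb[tU _]; apply: is_deriveB.
    by apply: is_derive_line; have [_ /(_ v) []] := hC _ tU.
  apply: is_derive_eq.
  move: ('D_v h z) (derive2 h z v v) => A B.
  by rewrite !scaler0 /GRing.scale /=; field.
have [||a a01] := @MVT R psi (fun t => 'D_v h (t *:
  v + z) - ('D_v h z + t * derive2 h z v v)) 0 1 ltr01.
- by move=> s; rewrite in_itv /= => /andP[s0 s1]; apply: dpsi; rewrite !ltW.
- by apply: derivable_within_continuous => s; rewrite in_itv /= => /dpsi [].
rewrite in_itv /= in a01; case/andP: a01 => a0 a1.
have [|c /andP[c0 c1] Ec] := @MVT_line _ _ ('D_v h) z (a *: v).
  move=> c /andP[c0 c1]; rewrite scalerA.
  have [//|cU _] := inb (c * a) _; first by rewrite mulr_ge0 ?mulr_ile1// ?ltW.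
  by have [_ _ /(_ v (a *: v)) []] := hC _ cU.
have ca : 0 <= c * a <= 1 by rewrite mulr_ge0 ?mulr_ile1// ?ltW.
have [cU cD] := inb (c * a) ca.
rewrite /psi scale1r scale0r add0r !mul0r expr0n/= mul0r addr0 subr0 subr0
  mulr1 expr1n !mul1r.
rewrite [v + z]addrC [a *: v + z]addrC => E.
rewrite (_ : _ - _ = a * (derive2 h (c * a *: v + z) v v - derive2 h z v v)).
  rewrite normrM gtr0_norm//; apply: le_trans (cD v).
  by rewrite ler_piMl// ltW.
have {}Ec : 'D_v h (z + a *: v) - 'D_v h z = a * derive2 h ((c * a) *:
  v + z) v v.
  by rewrite [z + _]addrC Ec scalerA; exact: (derive2_linr v oU hC cU).2.
move: E Ec; move: (h (z + v)) (h z) ('D_v h z) ('D_v h (z + a *: v)).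
move: (derive2 h ((c * a) *: v + z) v v) (derive2 h z v v) => A B C D E F.
lra.
Qed.

Lemma rcoord_le_norm w i : `|rcoord w i| <= `|w|.
Proof.
rewrite prod_normE le_max /Num.norm/= !mx_normrE; apply/orP.
case: i => j; [left|right].
  exact: (le_bigmax _ (fun i : 'I_1 * 'I_N => `|w.1 i.1 i.2|) (ord0, j)).
exact: (le_bigmax _ (fun i : 'I_1 * 'I_N => `|w.2 i.1 i.2|) (ord0, j)).
Qed.

(** Links the differential in [C2_defining] with the directional derivatives in [C2_on]: continuous
    partial derivatives give differentiability, by the mean value theorem along segments. *)
Lemma diff_derive U h z v : open U -> C2_on U h -> U z -> 'd h z v = 'D_v h z.
Proof.
move=> oU hC zU.
have hl y : U y -> lin_fun (fun w => 'D_w h y).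
  by move=> yU; exact: C1_near_lin (C2_C1_near oU hC yU).
have [lD lZ] := hl z zU.
have lin : linear (fun w => 'D_w h z : R^o) by move=> a u w; rewrite lD lZ.
pose L : {linear Cn R N -> R^o} :=
  HB.pack (fun w => 'D_w h z : R^o) (GRing.isLinear.Build _ _ _ _ _ lin).
suff -> : 'd h z = L :> (Cn R N -> R) by [].
apply: diff_unique; first exact: continuous_lin (hl z zU).
apply/eqaddoP => e e0; pose k := e / (N + N).+1%:R.
have k0 : 0 < k by rewrite divr_gt0.
pose F i (y : Cn R N) : Prop := `|'D_(rbasis R i) h y - 'D_(rbasis R i) h z| <=
  k.
have nF : nbhs z (fun y => forall i, F i y).
  apply: (@filter_forall _ _ F (nbhs z) _) => i.
  have [_ Hz _] := hC z zU; exact: (continuous_near (Hz (rbasis R i)).2 k0).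
have nU : nbhs z U by exact: open_nbhs_nbhs.
have nUF : nbhs z (U `&` (fun y => forall i, F i y)) by exact: filterI.
have /nbhs_ballP[d /= d0 hd] := nUF.
apply/nbhs_ballP; exists d => //= w; rewrite -ball_normE /= sub0r normrN => wd.
have inb (t : R) : 0 <= t <= 1 -> (U `&` (fun y =>
  forall i, F i y)) (t *: w + z).
  move=> /andP[t0 t1]; apply: hd; rewrite -ball_normE /= opprD addrCA subrr
    addr0.
  by rewrite normrN normrZ ger0_norm//; apply: le_lt_trans wd; rewrite ler_piMl.
have [|c /andP[c0 c1] Ec] := @MVT_line _ _ h z w.
  by move=> t /inb[tU _]; have [_ /(_ w) []] := hC _ tU.
have [cU cF] := inb c ltac:(by rewrite !ltW).
rewrite [X in `|X|](_ : _ = 'D_w h (c *: w + z) - 'D_w h z); last first.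
  rewrite -Ec /=.
  change (h (w + z) - (h z + 'D_w h z) = h (w + z) - h z - 'D_w h z).
  by rewrite opprD addrA.
rewrite (lin_fun_sum w (hl _ cU)) (lin_fun_sum w (hl _ zU)) -sumrB.
apply: le_trans (ler_norm_sum _ _ _) _.
apply: le_trans (_ : \sum_(i : 'I_N + 'I_N) `|w| * k <= _).
  apply: ler_sum => i _; rewrite -mulrBr normrM; apply: ler_pM => //.
    exact: rcoord_le_norm.
  exact: cF.
rewrite sumr_const card_sum !card_ord /k -[_ *+ (N + N)]mulr_natr -mulrA mulrC.
apply: ler_wpM2r => //.
rewrite mulrAC ler_pdivrMr//; apply: ler_wpM2l; first exact: ltW.
by rewrite ler_nat leqnSn.
Qed.

Lemma derive2E h z v w : derive2 h z v w = 'D_w ('D_v h) z.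
Proof. by []. Qed.

Lemma mulI_dirx j : mulI (dirx R j) = diry R j :> Cn R N.
Proof. by rewrite /mulI /= oppr0. Qed.

Lemma mulIK v : mulI (mulI v) = - v.
Proof. by []. Qed.

Lemma C2_sub U U' h : U' `<=` U -> C2_on U h -> C2_on U' h.
Proof. by move=> s hC z /s; exact: hC. Qed.

End SecondOrder.
(* Otherwise unification unfolds derivatives down to limits of filters and
   compares dirx with diry coordinatewise, which takes forever. *)
Opaque derive2 dirx diry derive.

(** * The complex Hessian *)

Section Complex.
Variables (R : realType) (N : nat).
Implicit Types (U : set (Cn R N)) (h : Cn R N -> R) (v z : Cn R N).
Local Open Scope complex_scope.
Local Open Scope sesquilinear_scope.

Lemma conj_conjc (x : R[i]) : Num.conj x = conjc x.
Proof. by []. Qed.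

Lemma Re_sum I (r : seq I) (F : I -> R[i]) :
  complex.Re (\sum_(i <- r) F i) = \sum_(i <- r) complex.Re (F i).
Proof. by apply: (big_morph _ _ _) => // -[a b] [c d]. Qed.

Lemma toCK v : ofC (toC v) = v.
Proof. by case: v => x y; congr pair; apply/rowP => j; rewrite !mxE. Qed.

Lemma ofCK (w : 'rV[R[i]]_N) : toC (ofC w) = w.
Proof. by apply/rowP => j; rewrite !mxE /=; case: (w ord0 j). Qed.

Lemma ofCD (w w' : 'rV[R[i]]_N) : ofC (w + w') = ofC w + ofC w'.
Proof.
congr pair; apply/rowP => j; rewrite !mxE /=.
  by case: (w ord0 j) (w' ord0 j) => [a b] [c d].
by case: (w ord0 j) (w' ord0 j) => [a b] [c d].
Qed.

Lemma toCD v w : toC (v + w) = toC v + toC w.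
Proof. by rewrite -[v]toCK -[w]toCK -ofCD !ofCK. Qed.

Lemma toCZ (a : R) v : toC (a *: v) = a%:C *: toC v.
Proof. by apply/rowP => j; rewrite !mxE; simpc. Qed.

Lemma ofCZ (a : R) (w : 'rV[R[i]]_N) : ofC (a%:C *: w) = a *: ofC w.
Proof. by rewrite -[w]ofCK -toCZ !toCK. Qed.

Lemma toC_mulI v : toC (mulI v) = 'i%C *: toC v.
Proof. by apply/rowP => j; rewrite !mxE; simpc. Qed.

Lemma ofC_i (w : 'rV[R[i]]_N) : ofC ('i%C *: w) = mulI (ofC w).
Proof. by rewrite -[w]ofCK -toC_mulI !toCK. Qed.

Lemma csqnorm_toC v : csqnorm (toC v) = (sqnorm v)%:C.
Proof.
rewrite /csqnorm sqnormE rmorph_sum; apply: eq_bigr => j _.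
by rewrite -add_Re2_Im2 !mxE.
Qed.

Lemma sqnorm_mulI v : sqnorm (mulI v) = sqnorm v.
Proof. by rewrite !sqnormE; apply: eq_bigr => j _; rewrite mxE sqrrN addrC. Qed.

(** Stated for plain real numbers, so that the four derivatives in an entry are matched one at a
    time. *)
Lemma cplx_hessian_entry_congr (a b c d a' b' c' d' : R) : a = a' ->
  b = b' -> c = c' -> d = d' ->
  ((a + b) / 4) +i* ((c - d) / 4) = ((a' + b') / 4) +i* ((c' - d') / 4).
Proof. by move=> -> -> -> ->. Qed.

Lemma cplx_hessian_derive2 U h z : open U -> C2_on U h -> U z ->
  cplx_hessian h z = \matrix_(j, k)
    (((derive2 h z (dirx R j) (dirx R k) + derive2 h z (diry R j) (diry R k)) /
      4) +i*
     ((derive2 h z (dirx R j) (diry R k) - derive2 h z (diry R j) (dirx R k)) /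
       4)).
Proof.
move=> oU hC zU.
have S u v : 'D_u ('D_v h) z = derive2 h z u v
  by rewrite (derive2_sym u v oU hC zU) derive2E.
apply/matrixP => j k; rewrite [LHS]mxE [RHS]mxE.
by apply: cplx_hessian_entry_congr; apply: S.
Qed.

Lemma cplx_hessian_herm U h z : open U -> C2_on U h -> U z ->
  cplx_hessian h z = (cplx_hessian h z)^t*.
Proof.
move=> oU hC zU; rewrite (cplx_hessian_derive2 oU hC zU).
apply/matrixP => j k; rewrite !mxE conj_conjc /=.
have S u v := derive2_sym u v oU hC zU.
rewrite -mulNr opprB.
by apply: cplx_hessian_entry_congr; apply: S.
Qed.

Lemma quad_split (b : Cn R N -> Cn R N -> R) v :
  (forall u, lin_fun (b u)) -> (forall u, lin_fun (b^~ u)) ->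
  b v v = \sum_j \sum_k
    (v.1 0 j * v.1 0 k * b (dirx R j) (dirx R k) +
     v.1 0 j * v.2 0 k * b (dirx R j) (diry R k) +
     (v.2 0 j * v.1 0 k * b (diry R j) (dirx R k) +
     v.2 0 j * v.2 0 k * b (diry R j) (diry R k))).
Proof.
move=> br bl; rewrite (quad_sum v v br bl) big_sumType /= -big_split /=.
apply: eq_bigr => j _; rewrite big_sumType /= -big_split /=.
rewrite [X in _ + X]big_sumType /= -big_split /= -big_split /=.
by apply: eq_bigr => k _; rewrite !(ord1 ord0).
Qed.

(** The form of a Hermitian matrix is real, so it is enough to compare real parts, coordinate by
    coordinate. *)
Lemma levi4_hform U h z v : open U -> C2_on U h -> U z ->
  hform (cplx_hessian h z) (toC v) = (levi4 h z v / 4)%:C.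
Proof.
move=> oU hC zU; have hH := cplx_hessian_herm oU hC zU.
rewrite -(RRe_real (hform_real (toC v) hH)); congr (_%:C).
rewrite (cplx_hessian_derive2 oU hC zU) /levi4.
have Sr u := derive2_linr u oU hC zU; have Sl u := derive2_linl u oU hC zU.
rewrite (quad_split v Sr Sl) (quad_split (mulI v) Sr Sl) -big_split /=.
rewrite /hform mxE.
rewrite (eq_bigr (fun k => \sum_j toC v 0 j *
  (((derive2 h z (dirx R j) (dirx R k) + derive2 h z (diry R j) (diry R k)) /
    4) +i*
     ((derive2 h z (dirx R j) (diry R k) - derive2 h z (diry R j) (dirx R k)) /
       4))
  * (toC v 0 k)^*)); last first.
  move=> k _; rewrite mxE mulr_suml; apply: eq_bigr => j _.
  by congr (_ * _ * _); rewrite !mxE.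
rewrite exchange_big /= Re_sum mulr_suml; apply: eq_bigr => j _.
rewrite Re_sum -big_split /= mulr_suml; apply: eq_bigr => k _.
rewrite !mxE /=.
move: (derive2 h z (dirx R j) (dirx R k)) (derive2 h z (dirx R j) (diry R k)).
move: (derive2 h z (diry R j) (dirx R k)) (derive2 h z (diry R j) (diry R k)).
move: (v.1 0 j) (v.2 0 j) (v.1 0 k) (v.2 0 k).
move=> x y x' y' A B C D.
by field.
Qed.

Lemma levi4_pluriharmonic U h z v : open U -> C2_on U h -> U z ->
  cplx_hessian h z = 0 ->
  levi4 h z v = 0.
Proof.
move=> oU hC zU H0; have := levi4_hform v oU hC zU.
rewrite H0 /hform mulmx0 mul0mx mxE => /complexI /esym /eqP.
by rewrite mulf_eq0 invr_eq0 pnatr_eq0 orbF => /eqP.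
Qed.

End Complex.

(** * Isometric complex-linear embeddings and the Levi form on their images *)

Section LinearMaps.
Variables (R : realType) (N : nat).
Implicit Types (U : set (Cn R N)) (h : Cn R N -> R) (z : Cn R N).
Local Open Scope complex_scope.

Definition plane_map k (A : 'M[R[i]]_(k, N)) (w : Cn R k) :
  Cn R N := ofC (toC w *m A).

Lemma affine_planeE k a (A : 'M[R[i]]_(k, N)) w :
  affine_plane a A w = a + plane_map A w.
Proof. by rewrite /affine_plane ofCD toCK. Qed.

Lemma plane_mapD k (A : 'M[R[i]]_(k, N)) v w :
  plane_map A (v + w) = plane_map A v + plane_map A w.
Proof. by rewrite /plane_map toCD mulmxDl ofCD. Qed.

Lemma plane_mapZ k (A : 'M[R[i]]_(k, N)) (a : R) w : plane_map A (a *: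
  w) = a *: plane_map A w.
Proof. by rewrite /plane_map toCZ -scalemxAl ofCZ. Qed.

Lemma plane_map0 k (A : 'M[R[i]]_(k, N)) : plane_map A 0 = 0.
Proof. by rewrite -(scale0r 0) plane_mapZ scale0r. Qed.

Lemma plane_map_mulI k (A : 'M[R[i]]_(k, N)) w :
  plane_map A (mulI w) = mulI (plane_map A w).
Proof. by rewrite /plane_map toC_mulI -scalemxAl ofC_i. Qed.

Lemma sqnorm_plane_map k (A : 'M[R[i]]_(k, N)) w : A \is unitarymx ->
  sqnorm (plane_map A w) = sqnorm w.
Proof.
move=> uA; apply: complexI; rewrite -!csqnorm_toC /plane_map ofCK.
exact: csqnorm_unitary.
Qed.

Lemma lin_plane_map k (A : 'M[R[i]]_(k, N)) (l : Cn R N -> R) : lin_fun l ->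
  lin_fun (fun w => l (plane_map A w)).
Proof. by move=> [lD lZ]; split=> *; rewrite ?plane_mapD ?plane_mapZ ?lD ?lZ.
  Qed.

Lemma levi4_near U h z (k : R) : open U -> C2_on U h -> U z -> 0 < k ->
  \forall y \near z, forall v, `|levi4 h y v - levi4 h z v| <= k * sqnorm v.
Proof.
move=> oU hC zU k0; have k20 : 0 < k / 2 by rewrite divr_gt0.
apply: filterS (derive2_near oU hC zU k20) => y H v.
rewrite /levi4; have := H v; have := H (mulI v); rewrite sqnorm_mulI.
move: (derive2 h y v v) (derive2 h z v v) (derive2 h y (mulI v) (mulI v))
  (derive2 h z (mulI v) (mulI v)).
move: (sqnorm v) => s a b c d; rewrite !ler_norml.
move=> /andP[? ?] /andP[? ?]; apply/andP; split; lra.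
Qed.

Lemma levi4_plane_map_hform U h z k (A : 'M[R[i]]_(k, N)) w : open U ->
  C2_on U h -> U z ->
  hform (cplx_hessian h z) (toC w *m A) = (levi4 h z (plane_map A w) / 4)%:C.
Proof. by move=> oU hC zU; rewrite -(levi4_hform _ oU hC zU) /plane_map ofCK.
  Qed.

(** Turns an eigenvalue count at one point into positivity on one fixed frame at all nearby points:
    at z the frame gives [levi4] at least 4 l |w|^2, and the perturbation costs at most l |w|^2. *)
Lemma pos_eigenvalues_near U h z k : open U -> C2_on U h -> U z ->
  at_least_pos_eigenvalues k (cplx_hessian h z) ->
  exists (P : 'M[R[i]]_(k, N)) (l : R), [/\ P \is unitarymx, 0 < l &
    \forall y \near z, forall w, l * sqnorm w <= levi4 h y (plane_map P w)].
Proof.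
move=> oU hC zU [s [sE ks]].
have [P [l [uP l0 lP]]] := pos_eigenvalues_frame (cplx_hessian_herm oU hC zU)
  sE ks.
have lR : l = (complex.Re l)%:C by rewrite RRe_real// gtr0_real.
move: l0 lP; rewrite lR; move: (complex.Re l) => {sE ks lR}l;
  rewrite ltcR => l0 lP.
exists P, l; split => //.
apply: filterS (levi4_near oU hC zU l0) => y H w; have := H (plane_map P w).
have := lP (toC w); rewrite csqnorm_toC (levi4_plane_map_hform _ _ oU hC zU)
  -rmorphM /= lecR.
rewrite sqnorm_plane_map//; have := mulr_ge0 (ltW l0) (sqnorm_ge0 w);
  rewrite ler_norml.
move: (levi4 h y (plane_map P w)) (levi4 h z (plane_map P w)) (l * sqnorm w) =>
  a b c c0 bc /andP[? ?].
lra.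
Qed.

Lemma sqnorm_gt0 k (w : Cn R k) : w != 0 -> 0 < sqnorm w.
Proof. by rewrite lt_def sqnorm_ge0 andbT; apply: contra => /eqP h;
  rewrite (sqnorm_eq0 (w := w)) ?h. Qed.

Lemma pos_eigenvalues_of_frame U h z k (P : 'M[R[i]]_(k, N)) (l : R) :
  open U -> C2_on U h -> U z -> 0 < l ->
  (forall w, l * sqnorm w <= levi4 h z (plane_map P w)) ->
  at_least_pos_eigenvalues k (cplx_hessian h z).
Proof.
move=> oU hC zU l0 lP.
apply: (@pos_frame_eigenvalues _ _ _ _ P (cplx_hessian_herm oU hC zU)) => u u0.
rewrite -[u]ofCK (levi4_plane_map_hform _ _ oU hC zU) ltcR divr_gt0//.
apply: lt_le_trans (lP _); rewrite mulr_gt0// sqnorm_gt0//.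
by apply: contra u0 => /eqP; rewrite -{2}[u]ofCK => ->; apply/eqP/rowP => j;
  rewrite !mxE.
Qed.

(** With k = N - q and m = q + 1 this finds, in any (q+1)-plane, a direction in which a strictly
    q-plurisubharmonic function has positive Levi form. *)
Lemma frame_meets_plane k m (P : 'M[R[i]]_(k, N)) (A : 'M[R[i]]_(m, N)) :
  (N < m + k)%N -> P \is unitarymx -> A \is unitarymx ->
  exists (w : Cn R m) (w' : Cn R k), [/\ w != 0, sqnorm w' = sqnorm w &
    plane_map A w = plane_map P w'].
Proof.
move=> hN uP uA.
have [u [v [u0 uv]]] := capped_vector hN (unitary_free uA) (unitary_free uP).
exists (ofC u), (ofC v).
have E : plane_map A (ofC u) = plane_map P (ofC v)
  by rewrite /plane_map !ofCK uv.
split=> //; last by rewrite -(sqnorm_plane_map _ uP) -E sqnorm_plane_map.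
apply: contra u0 => /eqP; rewrite -{2}[u]ofCK => ->.
by apply/eqP/rowP => j; rewrite !mxE.
Qed.

End LinearMaps.

(** * The maximum principle *)

Section FourPoint.
Variables (R : realType) (N : nat).
Implicit Types (U : set (Cn R N)) (h g : Cn R N -> R) (z v : Cn R N).

(* First-order terms cancel, and the pure second-order ones add up to the Levi
   form: this is the mean value over a circle, reduced to four points. *)
Definition four_points h z v : R :=
  h (z + v) + h (z - v) + (h (z + mulI v) + h (z - mulI v)) - 4 * h z.

Lemma near0_mulI (A : set (Cn R N)) : nbhs (0 : Cn R N) A ->
  \forall v \near (0 : Cn R N), [/\ A v, A (- v), A (mulI v) & A (- mulI v)].
Proof.
move=> /near0_sqnormP[r r0 hr]; apply/near0_sqnormP; exists r => // v vr.
by split; apply: hr; rewrite ?sqnormN ?sqnorm_mulI.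
Qed.

Lemma lin_fun0 (l : Cn R N -> R) : lin_fun l -> l 0 = 0.
Proof. by move=> [_ lZ]; rewrite -(scale0r 0) lZ mul0r. Qed.

Lemma lin_funN (l : Cn R N -> R) v : lin_fun l -> l (- v) = - l v.
Proof. by move=> [_ lZ]; rewrite -scaleN1r lZ mulN1r. Qed.

Lemma four_points_taylor U h z (k : R) : open U -> C2_on U h -> U z -> 0 < k ->
  \forall v \near (0 : Cn R N), `|four_points h z v - levi4 h z v| <= k *
    sqnorm v.
Proof.
move=> oU hC zU k0; have k40 : 0 < k / 4 by rewrite divr_gt0.
have := near0_mulI (taylor2 oU hC zU k40); apply: filterS => v.
have hl := C1_near_lin (C2_C1_near oU hC zU).
have DN w : derive2 h z (- w) (- w) = derive2 h z w w.
  rewrite (lin_funN _ (derive2_linl _ oU hC zU)) (lin_funN _ (derive2_linr _ oU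
    hC zU)).
  by rewrite opprK.
move=> [] /=; rewrite !sqnormN !sqnorm_mulI !DN (lin_funN v hl) (lin_funN (mulI
  v) hl).
rewrite /four_points /levi4.
move: (h (z + v)) (h (z - v)) (h (z + mulI v)) (h (z - mulI v)) (h z).
move: ('D_v h z) ('D_(mulI v) h z) (derive2 h z v v) (derive2 h z (mulI v)
  (mulI v)) (sqnorm v).
move=> a b c d e f g i j l; rewrite !ler_norml.
move=> /andP[? ?] /andP[? ?] /andP[? ?] /andP[? ?]; apply/andP; split; lra.
Qed.

Lemma four_points_sqnorm c z v : four_points (fun y =>
  sqnorm (y - c)) z v = 4 * sqnorm v.
Proof.
rewrite /four_points.
have E w : sqnorm (z + w - c) = sqnorm (z - c) + 2 * rdot (z - c) w + sqnorm w.
  by have -> : z + w - c = (z - c) + w by [rewrite addrAC]; exact: sqnormD.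
have dN w : rdot (z - c) (- w) = - rdot (z - c) w.
  by rewrite /rdot -sumrN; apply: eq_bigr => i _; rewrite rcoordN mulrN.
rewrite !E !dN !sqnormN !sqnorm_mulI.
move: (sqnorm (z - c)) (rdot _ _) (rdot _ _) (sqnorm v) => a b d e; ring.
Qed.

Lemma levi4Z U h z (t : R) v : open U -> C2_on U h -> U z ->
  levi4 h z (t *: v) = t ^+ 2 * levi4 h z v.
Proof.
move=> oU hC zU.
have E w : derive2 h z (t *: w) (t *: w) = t ^+ 2 * derive2 h z w w.
  rewrite (derive2_linl _ oU hC zU).2 (derive2_linr _ oU hC zU).2.
  by rewrite mulrA expr2.
have JZ : mulI (t *: v) = t *: mulI v by congr pair; rewrite scalerN.
by rewrite /levi4 JZ !E mulrDr.
Qed.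

Lemma near0_scale (A : set (Cn R N)) v : nbhs (0 : Cn R N) A ->
  exists2 t : R, 0 < t & A (t *: v).
Proof.
move=> /near0_sqnormP[r r0 hr]; have s0 := sqnorm_ge0 v.
exists (Num.min 1 (r / (sqnorm v + 1))).
  by rewrite lt_min ltr01 divr_gt0// ltr_wpDl.
apply: hr; rewrite sqnormZ; set t := Num.min _ _.
have t0 : 0 <= t by rewrite le_min ler01 divr_ge0 ?ltW// ltr_wpDl.
have t1 : t <= 1 by rewrite ge_min lexx.
have tr : t * (sqnorm v + 1) <= r by rewrite -ler_pdivlMr ?ltr_wpDl// ge_min
  lexx orbT.
nra.
Qed.

Lemma bounded_closed_compact_Cn (A : set (Cn R N)) (M : R) : closed A ->
  (forall z, A z -> `|z| <= M) -> compact A.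
Proof.
move=> cA AM.
pose B : set 'rV[R]_N := [set x | `|x| <= M].
have cB : compact B.
  apply: bounded_closed_compact.
    by exists M; split=> [|x Mx y /= By]; [exact: num_real|exact:
      le_trans By (ltW Mx)].
  apply: (@preimage_closed _ _ (fun x : 'rV[R]_N => `|x|) [set x | x <= M]).
    by move=> x _; exact: norm_continuous.
  exact: closed_le.
apply: (subclosed_compact cA (compact_setX cB cB)) => z /AM.
by rewrite prod_normE ge_max => /andP[].
Qed.

Lemma closure_eball_le (c z : Cn R N) (r : R) : closure (eball c r) z ->
  sqnorm (z - c) <= r ^+ 2.
Proof.
move=> cz; rewrite leNgt; apply/negP => rz.
have cs : {for z, continuous (fun y : Cn R N => sqnorm (y - c))}.
  apply: continuous_comp; last exact: continuous_sqnorm.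
  by apply: cvgB; [exact: cvg_id|exact: cvg_cst].
have nz : \forall y \near z, r ^+ 2 < sqnorm (y - c).
  by apply: (cs [set x | r ^+ 2 < x]); exact: lt_nbhsr.
have [y [/eballE yr ry]] := cz _ nz.
by have := lt_trans yr ry; rewrite ltxx.
Qed.

Lemma compact_closed_eball (c : Cn R N) (r : R) : 0 < r ->
  compact (closure (eball c r)).
Proof.
move=> r0; apply: (@bounded_closed_compact_Cn _ (r + `|c|));
  first exact: closed_closure.
move=> z /closure_eball_le /(norm_le_sqnorm (ltW r0)) zr.
by rewrite -[z](subrK c); apply: le_trans (ler_normD _ _) _; rewrite lerD2r.
Qed.

Lemma open_eball (c : Cn R N) (r : R) : open (eball c r).
Proof.
rewrite openE => z /eballE zr.
have cs : {for z, continuous (fun y : Cn R N => sqnorm (y - c))}.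
  apply: continuous_comp; last exact: continuous_sqnorm.
  by apply: cvgB; [exact: cvg_id|exact: cvg_cst].
have nz : \forall y \near z, sqnorm (y - c) < r ^+ 2.
  by apply: (cs [set x | x < r ^+ 2]); exact: lt_nbhsl.
by apply: filterS nz => y; rewrite eballE.
Qed.

Lemma not_in_ball_bd (c z : Cn R N) (r : R) : closure (eball c r) z ->
  ~ eball c r z -> bd (eball c r) z.
Proof.
by move=> cz nz; split=> //; rewrite (interior_id _).1//; exact: open_eball.
Qed.

End FourPoint.

Section MaximumPrinciple.
Variables (R : realType) (N : nat).
Implicit Types (U V : set (Cn R N)) (g : Cn R N -> R) (z : Cn R N).

Lemma plane_mapN k (A : 'M[R[i]]_(k, N)) v :
  plane_map A (- v) = - plane_map A v.
Proof. by rewrite -scaleN1r plane_mapZ scaleN1r. Qed.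

Lemma affine_plane_nbhs k (a : Cn R N) (A : 'M[R[i]]_(k, N)) w (B :
  set (Cn R N)) :
  A \is unitarymx -> nbhs (affine_plane a A w) B ->
  nbhs w (affine_plane a A @^-1` B).
Proof.
move=> uA /nbhs_sqnormP[r r0 hr]; apply/nbhs_sqnormP; exists r => // y yr;
  apply: hr.
rewrite !affine_planeE.
have -> : a + plane_map A y - (a + plane_map A w) = plane_map A (y - w).
  by rewrite plane_mapD plane_mapN opprD addrACA subrr add0r.
by rewrite sqnorm_plane_map.
Qed.

Lemma affine_plane_continuous k (a : Cn R N) (A : 'M[R[i]]_(k, N)) :
  A \is unitarymx -> continuous (affine_plane a A).
Proof. by move=> uA w B nB; exact: affine_plane_nbhs. Qed.

Lemma usc_on_EFin m (A : set (Cn R m)) (g : Cn R m -> R) :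
  (forall x, A x -> {for x, continuous g}) -> usc_on A (EFin \o g).
Proof.
move=> gc x Ax; split=> [|a]; first exact: ltry.
rewrite lte_fin => ga; have H : \forall y \near x, g y < a.
  by apply: (gc x Ax [set t | t < a]); exact: lt_nbhsl.
by apply: cvg_within; apply: filterS H => y; rewrite /= lte_fin.
Qed.

(** If g - h were positive somewhere in the ball, adding a small eta |y - c|^2 would leave the
    maximum at an interior point, where the four-point sum is nonpositive. Along a small multiple of
    the direction u given by the hypothesis that sum is at least (4 - 1 - 1) eta |t u|^2: 4 from the
    added square, one Taylor error each from g and h. *)
Lemma qpsh_of_levi4 V g q : open V -> C2_on V g ->
  (forall z (A : 'M[R[i]]_(q.+1, N)), V z -> A \is unitarymx ->
     exists2 u : Cn R q.+1, u != 0 & 0 <= levi4 g z (plane_map A u)) ->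
  qpsh_on q V (EFin \o g).
Proof.
move=> oV gC glev; split.
  by apply: usc_on_EFin => x /gC [].
move=> a A uA; have affc := @affine_plane_continuous _ a A uA.
have gac x : V (affine_plane a A x) -> {for x,
  continuous (g \o affine_plane a A)}.
  by move=> Vx; apply: continuous_comp; [exact: affc|have [] := gC _ Vx].
split; first exact: usc_on_EFin.
move=> c r r0 cU W h oW cW [hC hH] hbd w wB.
rewrite /= lee_fin leNgt; apply/negP => hw.
pose F y := g (affine_plane a A y) - h y.
have [dl dlE dl0] : exists2 dl, dl = F w & 0 < dl by exists (F w);
  rewrite // subr_gt0.
have r20 : 0 < 2 * r ^+ 2 by rewrite mulr_gt0// exprn_gt0.
(* On the sphere g - h is at most 0, so the perturbed function is at most dl / 2 there, below its
   value at w. *)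
have [eta eta0 etar] : exists2 eta : R, 0 < eta & eta * r ^+ 2 <= dl / 2.
  exists (dl / (2 * r ^+ 2)); first by rewrite divr_gt0.
  rewrite le_eqVlt; apply/orP; left; apply/eqP.
  by field; rewrite gt_eqF.
pose G y := F y + eta * sqnorm (y - c).
set K := closure (eball c r).
have wK : K w by exact: subset_closure.
have Gc : {within K, continuous G}.
  apply: continuous_in_subspaceT => y /[!inE] Ky.
  apply: cvgD.
    apply: cvgB; first by apply: gac; exact: cU.
    by have [] := hC _ (cW _ Ky).
  apply: cvgM; first exact: cvg_cst.
  apply: continuous_comp; last exact: continuous_sqnorm.
  by apply: cvgB; [exact: cvg_id|exact: cvg_cst].
have [y0 y0K ymax] := compact_EVT_max (ex_intro _ w wK) (compact_closed_eball
  r0) Gc.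
rewrite inE in y0K.
have y0B : eball c r y0.
  apply: contrapT => nB; have := ymax w (mem_set wK).
  have := hbd _ (not_in_ball_bd y0K nB); rewrite /= lee_fin => h1.
  have h2 : eta * sqnorm (y0 - c) <= dl / 2.
    by apply: le_trans etar; apply: ler_wpM2l;
      [exact: ltW|exact: closure_eball_le].
  have h3 : 0 <= eta * sqnorm (w - c) by rewrite mulr_ge0 ?sqnorm_ge0// ltW.
  move: h1 h2 h3 dl0 dlE; rewrite /G /F.
  move: (g _) (g _) (h y0) (h w) (eta * _) (eta * _) => t1 t2 t3 t4 t5 t6; lra.
have Vy0 : V (affine_plane a A y0) by exact: cU.
have [u u0 levu] := glev _ A Vy0 uA.
have eta40 : 0 < eta by [].
have nball : \forall v \near (0 : Cn R q.+1), eball c r (y0 + v).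
  have : nbhs y0 (eball c r) by apply: open_nbhs_nbhs; split=> //;
    exact: open_eball.
  move=> /nbhs_sqnormP[s s0 hs]; apply/near0_sqnormP; exists s => // v vs;
    apply: hs.
  by rewrite addrAC subrr add0r.
have n1 := near0_mulI nball.
have n2 := four_points_taylor oW hC (cW _ y0K) eta40.
have n3 : \forall v \near (0 : Cn R q.+1),
    `|four_points g (affine_plane a A y0) (plane_map A v) - levi4 g
      (affine_plane a A y0) (plane_map A v)|
      <= eta * sqnorm (plane_map A v).
  have /near0_sqnormP[s s0 hs] := four_points_taylor oV gC Vy0 eta40.
  by apply/near0_sqnormP; exists s => // v vs; apply: hs;
    rewrite sqnorm_plane_map.
have [t t0 /= [[[b1 b2 b3 b4] X2] X3]] := near0_scale u (filterI (filterI n1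
  n2) n3).
have aE v : affine_plane a A (y0 + v) = affine_plane a A y0 + plane_map A v.
  by rewrite !affine_planeE plane_mapD addrA.
have levh0 : levi4 h y0 (t *: u) = 0.
  by apply: (levi4_pluriharmonic _ oW hC (cW _ y0K)); apply: hH; exact: cW.
have su : 0 < sqnorm (t *: u) by rewrite sqnormZ mulr_gt0 ?exprn_gt0//
  sqnorm_gt0.
have levt : 0 <= levi4 g (affine_plane a A y0) (plane_map A (t *: u)).
  by rewrite plane_mapZ (levi4Z _ _ oV gC Vy0) mulr_ge0// exprn_ge0// ltW.
rewrite sqnorm_plane_map// in X3; rewrite levh0 subr0 in X2.
have Gm v : eball c r (y0 + v) -> G (y0 + v) <= G y0.
  by move=> vB; apply: ymax; rewrite inE; exact: subset_closure.
have := four_points_sqnorm c y0 (t *: u).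
move: (Gm _ b1) (Gm _ b2) (Gm _ b3) (Gm _ b4) X2 X3;
  rewrite /G /F /four_points !aE.
rewrite !plane_mapN !plane_map_mulI.
move: (g (affine_plane a A y0 + plane_map A (t *:
  u))) (g (affine_plane a A y0 - plane_map A (t *: u)))
  (g (affine_plane a A y0 + mulI (plane_map A (t *:
    u)))) (g (affine_plane a A y0 - mulI (plane_map A (t *: u))))
  (g (affine_plane a A y0)) (h (y0 + t *: u)) (h (y0 - t *: u))
  (h (y0 + mulI (t *: u))) (h (y0 - mulI (t *: u))) (h y0)
  (sqnorm (y0 + t *: u - c)) (sqnorm (y0 - t *: u - c))
  (sqnorm (y0 + mulI (t *: u) - c)) (sqnorm (y0 - mulI (t *:
    u) - c)) (sqnorm (y0 - c)).
move: (sqnorm (t *: u)) (levi4 g (affine_plane a A y0) (plane_map A (t *: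
  u))) su levt eta0.
clear; move=> s l s0 l0 e0 g1 g2 g3 g4 g0 h1 h2 h3 h4 h0 s1 s2 s3 s4 s5.
move=> G1 G2 G3 G4; rewrite !ler_norml => /andP[H1 H2] /andP[H3 H4].
move=> /(congr1 (fun x => eta * x)) E.
have := mulr_gt0 e0 s0.
lra.
Qed.

End MaximumPrinciple.

(** * Quadratic pluriharmonic polynomials *)

Section QuadraticPluriharmonic.
Variables (R : realType) (N : nat).
Variables (c0 : R) (l : Cn R N -> R) (b : Cn R N -> Cn R N -> R).
Hypotheses (hl : lin_fun l) (br : forall u, lin_fun (b u)).
Hypotheses (bs : forall u v, b u v = b v u) (bJ : forall u v,
  b (mulI u) (mulI v) = - b u v).

(** By [bJ] the form b is the real part of the complex bilinear form b(u, v) - i b(iu, v), so this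
    is the real part of a holomorphic polynomial of degree at most two. *)
Definition quadpoly (z : Cn R N) : R := c0 + l z + b z z.

Lemma is_derive_quadpoly (z v : Cn R N) : is_derive z v quadpoly (l v + 2 * b z
  v).
Proof.
apply: derive_of_line.
have -> : (fun s : R => quadpoly (s *: v + z)) =
    (fun s => quadpoly z + s * (l v + 2 * b z v) + s ^+ 2 * b v v).
  apply/funext => s; rewrite /quadpoly.
  rewrite hl.1 hl.2 (br _).1 (br _).2 [b _ v]bs [b _ z]bs (br _).1 (br _).2.
  rewrite (br _).1 (br _).2 [b v z]bs.
  move: (l v) (l z) (b v v) (b z v) (b z z) => ? ? ? ? ?; ring.
apply: is_derive_eq.
rewrite !scaler0 /GRing.scale /=; move: (l v) (b z v) (b v v) => ? ? ?; ring.
Qed.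

Lemma derive_quadpoly v : 'D_v quadpoly = fun z => l v + 2 * b z v.
Proof. by apply/funext => z; have [] := is_derive_quadpoly z v. Qed.

Lemma is_derive_derive_quadpoly (z v w : Cn R N) :
  is_derive z w ('D_v quadpoly) (2 * b w v).
Proof.
rewrite derive_quadpoly; apply: derive_of_line.
have -> : (fun s : R => l v + 2 * b (s *: w + z) v) =
    (fun s => l v + 2 * b z v + s * (2 * b w v)).
  apply/funext => s; rewrite bs (br _).1 (br _).2 ![b v _]bs.
  move: (l v) (b z v) (b w v) => ? ? ?; ring.
apply: is_derive_eq.
rewrite !scaler0 /GRing.scale /=; move: (b w v) => ?; ring.
Qed.

Lemma quadpoly_continuous : continuous quadpoly.
Proof.
have bsum w : b w w = \sum_i rcoord w i * b w (rbasis R i).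
  by rewrite {1}(lin_fun_sum w (br w)).
move=> z; apply: cvgD.
  by apply: cvgD; [exact: cvg_cst|exact: continuous_lin].
suff : {for z, continuous (fun w => b w w)} by [].
have -> : (fun w => b w w) = fun w => \sum_i rcoord w i * b w (rbasis R i).
  by apply/funext.
apply: (@continuous_sum _ _ (fun i w => rcoord w i * b w (rbasis R i))) => i.
apply: cvgM; first exact: continuous_rcoord.
suff : {for z, continuous (b^~ (rbasis R i))} by [].
have -> : (b^~ (rbasis R i)) = b (rbasis R i) by apply/funext => w; rewrite bs.
exact: continuous_lin.
Qed.

Lemma quadpoly_C2 U : C2_on U quadpoly.
Proof.
move=> z _; split; first exact: quadpoly_continuous.
  move=> v; split; first by have [] := is_derive_quadpoly z v.
  rewrite derive_quadpoly; apply: cvgD; first exact: cvg_cst.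
  apply: cvgM; first exact: cvg_cst.
  suff : {for z, continuous (b^~ v)} by [].
  have -> : (b^~ v) = b v by apply/funext => w; rewrite bs.
  exact: continuous_lin.
move=> v w; split; first by have [] := is_derive_derive_quadpoly z v w.
have -> : 'D_w ('D_v quadpoly) = fun=> 2 * b w v.
  by apply/funext => y; have [] := is_derive_derive_quadpoly y v w.
exact: cvg_cst.
Qed.

Lemma quadpoly_pluriharmonic U : pluriharmonic_on U quadpoly.
Proof.
split; first exact: quadpoly_C2.
move=> z _.
have E v w : 'D_w ('D_v quadpoly) z = 2 * b w v.
  by have [] := is_derive_derive_quadpoly z v w.
apply/matrixP => j k; rewrite [LHS]mxE [RHS]mxE.
have bN u v : b u (- v) = - b u v by rewrite -scaleN1r (br u).2 mulN1r.
(* Zero is written as an entry of the Hessian whose terms cancel: by [bJ] the yy derivative is minus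
   the xx one, and the yx derivative equals the xy one. *)
have -> : 0 = Complex ((2 * b (dirx R j) (dirx R k) - 2 * b (dirx R j) (dirx R
  k)) / 4)
    ((2 * b (dirx R j) (diry R k) - 2 * b (dirx R j) (diry R k)) / 4) :> R[i].
  by rewrite !subrr !mul0r.
apply: cplx_hessian_entry_congr.
- exact: E.
- by rewrite E -!mulI_dirx bJ mulrN.
- exact: E.
- by rewrite E -!mulI_dirx; congr (_ * _); rewrite -[RHS]opprK -bJ mulIK bN
  opprK.
Qed.

End QuadraticPluriharmonic.

(** * Upper semicontinuous functions *)

Section UpperSemicontinuity.
Variables (R : realType) (T : topologicalType).

(** The superlevel sets of the values of u generate a proper filter on K. A cluster point of it is a
    maximum: if u p < u x, semicontinuity gives a neighbourhood of p that misses the superlevel set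
    of x. *)
Lemma usc_max (K : set T) (u : T -> \bar R) : compact K -> K !=set0 ->
  usc_on K u ->
  exists2 x, K x & forall y, K y -> (u y <= u x)%E.
Proof.
move=> cK [k0 Kk0] uK.
pose B x := [set y | K y /\ (u x <= u y)%E].
have FB : ProperFilter (filter_from K B).
  apply: filter_from_proper; last by move=> x Kx; exists x; split.
  apply: filter_from_filter; first by exists k0.
  move=> x y Kx Ky; have [xy|yx] := leP (u x) (u y).
    by exists y => // z [Kz yz]; split; split=> //; exact: le_trans yz.
  by exists x => // z [Kz yz]; split; split=> //; apply: le_trans yz;
    exact: ltW.
have [] := cK _ FB; first by exists k0 => // z [].
move=> p [Kp clp]; exists p => // x Kx; rewrite leNgt; apply/negP => px.
(* [usc_on] uses real thresholds only, so one is inserted between the two extended values. *)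
have [a [pa ax]] : exists a : R, (u p < a%:E)%E /\ (a%:E <= u x)%E.
  case: (u x) px => [r px|px|]; last by rewrite ltNge leNye.
    by exists r; rewrite px lexx.
  case: (u p) px => [r _|//|_].
    by exists (r + 1); split; [rewrite lte_fin ltrDl|exact: leey].
  by exists 0; split; [exact: ltNyr|exact: leey].
have [_ /(_ a pa) nu] := uK p Kp.
have [y [[Ky xy] yn]] := clp (B x) _ (ex_intro2 _ _ x Kx (fun _ h => h)) nu.
have := yn Ky; apply/negP; rewrite -leNgt.
exact: le_trans ax xy.
Qed.

Lemma usc_on_comp (T' : topologicalType) (K : set T) (V : set T')
  (m : T -> T') (u : T' -> \bar R) (c : T -> R) :
  open V -> (forall p, K p -> V (m p)) -> continuous m -> continuous c ->
  usc_on V u -> usc_on K (fun p => (u (m p) + (c p)%:E)%E).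
Proof.
move=> oV KV mc cc uV p Kp; have [uy ua] := uV (m p) (KV _ Kp).
split=> [|a]; first by rewrite lte_add_pinfty ?ltry.
rewrite -lteBrDr// => h.
have [t [ut ta]] : exists t : R, (u (m p) < t%:E)%E /\ t < a - c p.
  move: h; rewrite -EFinB; case: (u (m p)) uy => [r _||_ _] //.
    rewrite lte_fin => h; exists ((r + (a - c p)) / 2).
    by split; [rewrite lte_fin|]; lra.
  by exists (a - c p - 1); rewrite ltNyr; split=> //; lra.
have nV : nbhs (m p) V by apply: open_nbhs_nbhs; split => //; exact: KV.
have H1 : nbhs (m p) [set y | (u y < t%:E)%E].
  by have := ua t ut; rewrite /within /=; apply: filterS2 nV => y Vy; exact.
have H2 : \forall x \near p, c x < a - t.
  by apply: (cc p [set x | x < a - t]); apply: lt_nbhsl; lra.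
have H3 : \forall x \near p, (u (m x) < t%:E)%E := mc p _ H1.
apply: cvg_within; apply: filterS2 H3 H2 => x /= ux cx.
rewrite -lteBrDr// -EFinB; apply: lt_trans ux _; rewrite lte_fin; lra.
Qed.

End UpperSemicontinuity.

(** * Uniform neighbourhoods, and strict touching by quadratic polynomials *)

Section Doubling.
Variables (R : realType) (N : nat).
Implicit Types (K V S : set (Cn R N)).

Lemma compact_uniform_nbhs K V : compact K -> (forall y, K y -> nbhs y V) ->
  exists2 d : R, 0 < d & forall x y : Cn R N, K y -> sqnorm (x - y) <= d -> V x.
Proof.
move=> /compact_near_coveringP cK KV.
pose P (d : R) (y : Cn R N) := forall x, sqnorm (x - y) <= d -> V x.
have H : \forall d \near (0:R)^'+, K `<=` P d.
  apply: cK => y /KV /nbhs_sqnormP[r r0 hr].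
  (* [sqnormD_le] doubles both squared distances, and 2 (r/4) + 2 (r/4) = r. *)
  have r40 : 0 < r / 4 by rewrite divr_gt0.
  exists ([set y' | sqnorm (y' - y) <= r / 4], [set d | d <= r / 4]).
    split; first by apply/nbhs_sqnormP; exists (r / 4).
    exact: nbhs_right_le.
  move=> [y' d] /= [h1 h2] x h3; apply: hr.
  rewrite -[x](subrK y') -addrA.
  apply: le_trans (sqnormD_le _ _) _; move:
    (sqnorm _) (sqnorm _) h1 h2 h3 => a b; lra.
have [d [d0 hd]] := filter_ex (filterI (nbhs_right_gt (0:R)) H).
by exists d => // x y Ky; exact: hd.
Qed.

Lemma quad_bound (b : Cn R N -> Cn R N -> R) :
  (forall u, lin_fun (b u)) -> (forall u, lin_fun (b^~ u)) ->
  exists2 M : R, 0 <= M & forall w, `|b w w| <= M * sqnorm w.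
Proof.
move=> br bl; pose k := \sum_i \sum_j `|b (rbasis R i) (rbasis R j)|.
exists (k * (N + N)%:R).
  by rewrite mulr_ge0// sumr_ge0// => i _; rewrite sumr_ge0.
move=> w; rewrite (quad_sum w w br bl); apply: quad_small => i j.
rewrite /k (bigD1 i) //= (bigD1 j) //= -addrA lerDl addr_ge0//.
  by rewrite sumr_ge0.
by rewrite sumr_ge0// => i' _; rewrite sumr_ge0.
Qed.

(** On the sphere of radius p the bound is the same polynomial with constant term c0 - e p^2, which
    is pluriharmonic. Subpluriharmonicity carries it to the centre, where it gives u 0 <= c0 - e p^2
    < c0. *)
Lemma no_strict_touch U (u : Cn R N -> \bar R) (c0 e : R) (l : Cn R N -> R)
    (b : Cn R N -> Cn R N -> R) :
  lin_fun l -> (forall u, lin_fun (b u)) -> (forall u v, b u v = b v u) ->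
  (forall u v, b (mulI u) (mulI v) = - b u v) -> 0 < e ->
  subpluriharmonic_on U u -> nbhs (0 : Cn R N) U ->
  (\forall w \near (0 : Cn R N), (u w <= (quadpoly c0 l b w - e * sqnorm
    w)%:E)%E) ->
  ~ (c0%:E <= u 0%R)%E.
Proof.
move=> hl br bs bJ e0 [_ uU] nU nu u0.
have nUu : nbhs (0 : Cn R N) (U `&`
  [set w | (u w <= (quadpoly c0 l b w - e * sqnorm w)%:E)%E]) by exact: filterI.
have /near0_sqnormP[r r0 hr] := nUu.
have [p p0 pr] : exists2 p : R, 0 < p & p ^+ 2 <= r.
  exists (Num.min 1 r); first by rewrite lt_min ltr01.
  have : Num.min 1 r <= 1 by rewrite ge_min lexx.
  have : Num.min 1 r <= r by rewrite ge_min lexx orbT.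
  have : 0 < Num.min 1 r by rewrite lt_min ltr01.
  nra.
have cr z : closure (eball (0 : Cn R N) p) z -> sqnorm z <= p ^+ 2.
  by move=> /closure_eball_le; rewrite subr0.
have cU : closure (eball (0 : Cn R N) p) `<=` U.
  by move=> z /cr zp; have [] := hr z (le_trans zp pr).
have q0 : quadpoly (c0 - e * p ^+ 2) l b 0 = c0 - e * p ^+ 2.
  by rewrite /quadpoly (lin_fun0 hl) (lin_fun0 (br 0)) !addr0.
have := uU 0 p p0 cU setT (quadpoly (c0 - e * p ^+ 2) l b) openT _
  (quadpoly_pluriharmonic (c0 - e * p ^+ 2) hl br bs bJ setT) _ 0 _.
rewrite q0 => H; have {}H : (u 0%R <= (c0 - e * p ^+ 2)%:E)%E.
  apply: H => //; last by apply/eballE; rewrite subr0 sqnorm0 exprn_gt0.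
  move=> z [/cr zp zi]; have [_] := hr z (le_trans zp pr).
  have zp' : p ^+ 2 <= sqnorm z.
    rewrite leNgt; apply/negP => zlt; apply: zi.
    by rewrite (interior_id _).1; [apply/eballE;
      rewrite subr0|exact: open_eball].
  rewrite /= => uz; apply: le_trans uz _; rewrite lee_fin /quadpoly.
  have := ler_wpM2l (ltW e0) zp'.
  move: (e * sqnorm z) (e * p ^+ 2) (l z) (b z z) => ? ? ? ?; lra.
have := le_trans u0 H; rewrite lee_fin.
have := mulr_gt0 e0 (exprn_gt0 2 p0); lra.
Qed.

End Doubling.

(** * The doubling argument *)

Section Touching.
Variables (R : realType) (N : nat).
Implicit Types (K V S : set (Cn R N)).

(* The complex (q+1)-plane through y directed by A stays in K near y once it is
   bent along nu by a quadratic pluriharmonic function, up to an arbitrarily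
   small multiple of |w|^2. *)
Definition touchable q K (y : Cn R N) :=
  exists (A : 'M[R[i]]_(q.+1, N)) (b : Cn R q.+1 -> Cn R q.+1 ->
    R) (nu : Cn R N),
  [/\ A \is unitarymx, forall u, lin_fun (b u), forall u v, b u v = b v u,
      forall u v, b (mulI u) (mulI v) = - b u v &
      forall eta : R, 0 < eta -> \forall w \near (0 : Cn R q.+1),
        K (y + plane_map A w - (b w w + eta * sqnorm w) *: nu)].

Lemma rdotDr (v w w' : Cn R N) : rdot v (w + w') = rdot v w + rdot v w'.
Proof. by rewrite /rdot -big_split; apply: eq_bigr => i _;
  rewrite rcoordD mulrDr. Qed.

Lemma rdotZr (v w : Cn R N) (a : R) : rdot v (a *: w) = a * rdot v w.
Proof. by rewrite /rdot mulr_sumr; apply: eq_bigr => i _;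
  rewrite rcoordZ mulrCA. Qed.

Lemma lin_rdot (v : Cn R N) : lin_fun (rdot v).
Proof. by split=> *; rewrite ?rdotDr ?rdotZr. Qed.

(* Moving (y, s) to (y + A w - theta nu, s + theta nu), with
   theta = b w w + eta |w|^2, keeps the first point in K, so maximality of the
   doubled functional bounds v on the plane through y + s by a pluriharmonic
   function minus a positive multiple of |w|^2. *)
Lemma touching_contra q K V v (y s : Cn R N) (e k dl C : R) :
  open V -> qpsh_on q V v -> 0 < e -> 0 <= k -> sqnorm s < dl -> V (y + s) ->
  (forall y' s', K y' -> sqnorm s' <= dl ->
     (v (y' + s')%R + (e * sqnorm (y' + s') - k * sqnorm s')%:E <= C%:E)%E) ->
  (C%:E <= v (y + s)%R + (e * sqnorm (y + s) - k * sqnorm s)%:E)%E ->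
  ~ touchable q K y.
Proof.
move=> oV [_ qV] e0 k0 sdl Vys hmax hC [A [b [nu [uA br bs bJ hK]]]].
have bl u : lin_fun (b^~ u).
  by have -> : b^~ u = b u by [apply/funext => w; rewrite bs]; exact: br.
have [M M0 hM] := quad_bound br bl.
pose x0 := y + s; pose n := sqnorm nu; pose d := rdot s nu.
have n0 : 0 <= n by exact: sqnorm_ge0.
have bound (a t : R) : 0 <= a -> 0 < t -> 0 < t / (a + 1) /\ a * (t / (a + 1))
  <= t.
  move=> a0 t0; have a10 : 0 < a + 1 by rewrite ltr_wpDl.
  split; first by rewrite divr_gt0.
  by rewrite mulrCA ler_piMr ?(ltW t0)// ler_pdivrMr// mul1r lerDl.
(* Budget for the gain e |w|^2: the term 2 k d eta |w|^2 may use e/4 of it and k n theta^2 may use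
   e/2, so that e/4 is left for [no_strict_touch]. *)
have [eta eta0 etad] : exists2 eta : R, 0 < eta & k * `|d| * eta <= e / 8.
  have e80 : 0 < e / 8 by rewrite divr_gt0.
  have [p1 q1] := bound _ _ (mulr_ge0 k0 (normr_ge0 d)) e80.
  by exists (e / 8 / (k * `|d| + 1)).
pose T := M + eta.
have T0 : 0 <= T by rewrite addr_ge0// ltW.
pose c := C - e * sqnorm x0 + k * sqnorm s.
(* The third bound pays for k n theta^2, as theta^2 <= T^2 r |w|^2. The fourth keeps |s + theta
   nu|^2 at most dl, within reach of the maximality hypothesis. *)
have [r [r0 r1 r2 r3]] : exists r : R, [/\ 0 < r, r <= 1,
    T ^+ 2 * n * k * r <= e / 2 & (2 * `|d| * T + T ^+ 2 * n) * r <= dl -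
      sqnorm s].
  pose a1 := T ^+ 2 * n * k; pose a2 := 2 * `|d| * T + T ^+ 2 * n.
  have a10 : 0 <= a1 by rewrite !mulr_ge0// exprn_ge0.
  have a20 : 0 <= a2 by rewrite addr_ge0 ?mulr_ge0// exprn_ge0.
  have e20 : 0 < e / 2 by rewrite divr_gt0.
  have ds0 : 0 < dl - sqnorm s by rewrite subr_gt0.
  have [p1 q1] := bound _ _ a10 e20; have [p2 q2] := bound _ _ a20 ds0.
  exists (Num.min 1 (Num.min (e / 2 / (a1 + 1)) ((dl - sqnorm s) / (a2 + 1))));
    split.
  - by rewrite !lt_min ltr01 p1 p2.
  - by rewrite ge_min lexx.
  - by apply: le_trans q1; rewrite ler_wpM2l// !ge_min lexx orbT.
  - by apply: le_trans q2; rewrite ler_wpM2l// !ge_min lexx !orbT.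
have hr : \forall w \near (0 : Cn R q.+1), sqnorm w <= r.
  by apply/near0_sqnormP; exists r.
(* Expanding e |x0 + A w|^2 and k |s + theta nu|^2 gives the constant c, the linear part l and the
   pluriharmonic part b' of the bound for v. *)
pose l w := - 2 * e * rdot x0 (plane_map A w).
pose b' u w := 2 * k * d * b u w.
have hl : lin_fun l.
  have [lD lZ] := lin_plane_map A (lin_rdot x0).
  by split=> *; rewrite /l ?lD ?lZ ?mulrDr// mulrCA.
have br' u : lin_fun (b' u).
  by have [lD lZ] := br u; split=> *; rewrite /b' ?lD ?lZ ?mulrDr// mulrCA.
have bs' u w : b' u w = b' w u by rewrite /b' bs.
have bJ' u w : b' (mulI u) (mulI w) = - b' u w by rewrite /b' bJ mulrN.
have a0 : affine_plane x0 A 0 = x0 by rewrite affine_planeE plane_map0 addr0.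
have nV : nbhs (0 : Cn R q.+1) (affine_plane x0 A @^-1` V).
  apply: affine_plane_nbhs => //; rewrite a0; exact: open_nbhs_nbhs.
apply: (@no_strict_touch R q.+1 _ _ c (e / 4) l b' hl br' bs' bJ' _ (qV x0 A
  uA) nV).
- by rewrite divr_gt0.
- apply: filterS2 hr (hK eta eta0) => w wr Kw.
  set th := b w w + eta * sqnorm w in Kw.
  have thT : `|th| <= T * sqnorm w.
    apply: le_trans (ler_normD _ _) _; rewrite mulrDl lerD// ger0_norm//.
    by rewrite mulr_ge0 ?sqnorm_ge0// ltW.
  have w0 := sqnorm_ge0 w.
  have th2 : th ^+ 2 <= T ^+ 2 * r * sqnorm w.
    rewrite -real_normK ?num_real//; apply: le_trans (_ :
      (T * sqnorm w) ^+ 2 <= _).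
      by rewrite ler_sqr ?nnegrE// mulr_ge0.
    rewrite exprMn -mulrA ler_wpM2l ?exprn_ge0// expr2.
    by rewrite ler_wpM2r.
  have sE : sqnorm (s + th *: nu) = sqnorm s + 2 * th * d + th ^+ 2 * n.
    by rewrite sqnormD rdotZr sqnormZ -/n -/d mulrA.
  have sdl' : sqnorm (s + th *: nu) <= dl.
    rewrite sE.
    have : 2 * th * d <= 2 * `|d| * T * r.
      rewrite -!mulrA ler_wpM2l//; apply: le_trans (ler_norm _) _.
      rewrite normrM mulrC ler_wpM2l//; apply: le_trans thT _.
      by rewrite ler_wpM2l.
    have : th ^+ 2 * n <= T ^+ 2 * n * r.
      apply: le_trans (ler_wpM2r n0 th2) _.
      have -> : T ^+ 2 * r * sqnorm w * n = T ^+ 2 * n * r * sqnorm w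
        by move: (sqnorm w) => ?; ring.
      apply: ler_piMr; last exact: le_trans wr r1.
      by rewrite !mulr_ge0 ?exprn_ge0// ltW.
    lra.
  have yE : y + plane_map A w - th *: nu + (s + th *: nu) = affine_plane x0 A w.
    by rewrite affine_planeE addrACA addNr addr0 addrAC.
  have := hmax _ _ Kw sdl'; rewrite yE /= -leeBrDr// => h; apply: le_trans h _.
  rewrite -EFinB lee_fin /quadpoly /l /b' /c.
  rewrite affine_planeE sqnormD sqnorm_plane_map// sE.
  have k1 : k * d * eta <= e / 8.
    apply: le_trans etad; apply: ler_wpM2r; first exact: ltW.
    by apply: ler_wpM2l; last exact: ler_norm.
  have k2 : k * n * th ^+ 2 <= e / 2 * sqnorm w.
    apply: le_trans (_ : k * n * (T ^+ 2 * r * sqnorm w) <= _).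
      by rewrite ler_wpM2l// mulr_ge0.
    apply: le_trans (ler_wpM2r w0 r2).
    by rewrite le_eqVlt; apply/orP; left; apply/eqP; ring.
  have := ler_wpM2r w0 k1.
  move: k2; rewrite /th.
  move: (b w w) (sqnorm w) (rdot x0 _) (sqnorm x0) (sqnorm s) => t1 t2 t3 t4 t5.
  lra.
- rewrite /= a0 /c; move: hC; rewrite -/x0 -leeBlDr// -EFinB => h.
  apply: le_trans h; rewrite lee_fin; lra.
Qed.

End Touching.

Section Doubling.
Variables (R : realType) (N : nat).
Implicit Types (K V S : set (Cn R N)).

Lemma ereal_lt_between (x : \bar R) (M : R) : (x < M%:E)%E ->
  exists2 M' : R, M' < M & (x < M'%:E)%E.
Proof.
case: x => [r||_] //; last by exists (M - 1); [lra|exact: ltNyr].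
rewrite lte_fin => rM; exists ((r + M) / 2); first lra.
by rewrite lte_fin; lra.
Qed.

Lemma usc_on_nbhs V (v : Cn R N -> \bar R) (M : R) y : open V -> usc_on V v ->
  V y -> (v y < M%:E)%E -> nbhs y [set x | (v x < M%:E)%E].
Proof.
move=> oV uV Vy vy; have [_ /(_ M vy)] := uV y Vy.
have nV : nbhs y V by exact: open_nbhs_nbhs.
by rewrite /within /=; apply: filterS2 nV => x Vx; exact.
Qed.

Lemma usc_on_sub (T : topologicalType) (A B : set T) (u : T ->
  \bar R) : A `<=` B ->
  usc_on B u -> usc_on A u.
Proof.
move=> AB uB x Ax; have [h1 h2] := uB x (AB _ Ax); split=> // a /h2.
rewrite /within /= => H.
by apply: (@filterS _ (nbhs x) _ _ _ _ H) => y Hy /AB.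
Qed.

Lemma compact_sqnorm_le (d : R) : 0 <= d ->
  compact [set s : Cn R N | sqnorm s <= d].
Proof.
move=> d0; apply: (@bounded_closed_compact_Cn _ _ _ (d + 1)).
  apply: (@preimage_closed (Cn R N) R (@sqnorm R N) [set x | x <= d] _
    (@closed_le R d)).
  by move=> x _; exact: continuous_sqnorm.
move=> z /= zd; apply: norm_le_sqnorm; first by rewrite addr_ge0.
by apply: le_trans zd _; nra.
Qed.

Lemma add_continuous_Cn : continuous (fun p : Cn R N * Cn R N => p.2 + p.1).
Proof. by move=> p; apply: cvgD; [exact: cvg_snd|exact: cvg_fst]. Qed.

(* v is not controlled outside K, so its maximum over K need not be a local one.
   The variable is doubled: v (y + s) + e |y + s|^2 - k |s|^2 is maximised over
   y in K and small s; for k large the maximum has s away from the boundary. *)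
Lemma max_meets q K S V v xs (M : R) : compact K -> open V -> K `<=` V ->
  qpsh_on q V v -> closed S -> S `<=` K ->
  (forall y, K y -> ~ S y -> touchable q K y) ->
  K xs -> v xs = M%:E -> (forall y, K y -> (v y <= M%:E)%E) ->
  exists2 y, S y & v y = M%:E.
Proof.
move=> cK oV KV qv cS SK hT Kxs vxs vM; apply: contrapT => nS.
have uV : usc_on V v by have [] := qv.
have Slt y : S y -> (v y < M%:E)%E.
  move=> Sy; rewrite lt_neqAle vM ?andbT; last exact: SK.
  by apply/eqP => vy; apply: nS; exists y.
(* Compactness of S and upper semicontinuity give a uniform gap below M; if S is empty any M' below
   M serves. *)
have [M' M'M SM'] : exists2 M' : R, M' < M & forall y, S y -> (v y < M'%:E)%E.
  have [[y0 Sy0]|] := pselect (S !=set0); last first.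
    by move=> S0; exists (M - 1); [lra|move=> y Sy; exfalso; apply: S0;
      exists y].
  have uS : usc_on S v by apply: usc_on_sub uV => y /SK /KV.
  have [y1 Sy1 y1max] := usc_max (subclosed_compact cS cK SK) (ex_intro _ _
    Sy0) uS.
  have [M' MM' y1M'] := ereal_lt_between (Slt _ Sy1).
  by exists M' => // y /y1max yy1; exact: le_lt_trans yy1 y1M'.
have [d1 d10 hd1] : exists2 d : R, 0 < d & forall x y : Cn R N, K y ->
  sqnorm (x - y) <= d -> V x.
  apply: (compact_uniform_nbhs cK) => y Ky.
  by apply: open_nbhs_nbhs; split => //; exact: KV.
have [d2 d20 hd2] : exists2 d : R, 0 < d &
    forall x y : Cn R N, S y -> sqnorm (x - y) <= d -> (v x < M'%:E)%E.
  apply: (@compact_uniform_nbhs _ _ S [set x | (v x < M'%:E)%E]).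
    exact: subclosed_compact cS cK SK.
  move=> y Sy; exact: usc_on_nbhs oV uV (KV _ (SK _ Sy)) (SM' _ Sy).
have [d [d0 dd1 dd2]] : exists d : R, [/\ 0 < d, d <= d1 & d <= d2].
  by exists (Num.min d1 d2); rewrite lt_min d10 d20 !ge_min !lexx orbT.
have subK (y s : Cn R N) : y + s - y = s by rewrite addrAC subrr add0r.
have inV y s : K y -> sqnorm s <= d -> V (y + s).
  by move=> Ky sd; apply: (hd1 _ y) => //; rewrite subK (le_trans sd).
have inM y s : S y -> sqnorm s <= d -> (v (y + s)%R < M'%:E)%E.
  by move=> Sy sd; apply: (hd2 _ y) => //; rewrite subK (le_trans sd).
have [B B0 KB] : exists2 B : R, 0 <= B & forall y, K y -> sqnorm y <= B.
  have uK : usc_on K (EFin \o @sqnorm R N).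
    by apply: usc_on_EFin => x _; exact: continuous_sqnorm.
  have [x Kx xmax] := usc_max cK (ex_intro _ _ Kxs) uK.
  by exists (sqnorm x); [exact: sqnorm_ge0|move=> y /xmax; rewrite lee_fin].
have D0 : 0 < 2 * (2 * B + 2 * d + 1) by nra.
(* Since |y + s|^2 <= 2 B + 2 d, the added term cannot close the gap between M' and M, so no pair
   with y in S reaches the value M. *)
have [e e0 eM] : exists2 e : R, 0 < e & e * (2 * B + 2 * d + 1) <= M - M'.
  exists ((M - M') / (2 * (2 * B + 2 * d + 1)));
    first by rewrite divr_gt0// subr_gt0.
  have -> : (M - M') / (2 * (2 * B + 2 * d + 1)) * (2 * B + 2 * d + 1) = (M -
    M') / 2.
    by field; rewrite gt_eqF//; nra.
  lra.
have sqys y s : K y -> sqnorm s <= d -> sqnorm (y + s) <= 2 * B + 2 * d.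
  by move=> /KB yB sd; have := sqnormD_le y s; lra.
pose P := [set s : Cn R N | sqnorm s <= d] `*` K.
have cP : compact P by apply: compact_setX => //; apply: compact_sqnorm_le;
  exact: ltW.
pose phi k (p : Cn R N * Cn R N) :=
  (v (p.2 + p.1)%R + (e * sqnorm (p.2 + p.1) - k * sqnorm p.1)%:E)%E.
have uphi k : usc_on P (phi k).
  apply: (@usc_on_comp _ _ _ P V (fun p => p.2 + p.1) v
    (fun p => e * sqnorm (p.2 + p.1) - k * sqnorm p.1)) => //.
  - by move=> [s y] [/= sd Ky]; exact: inV.
  - exact: add_continuous_Cn.
  - move=> p; apply: cvgB; apply: cvgM; try exact: cvg_cst.
      by apply: continuous_comp; [exact: add_continuous_Cn|exact:
        continuous_sqnorm].
    by apply: continuous_comp; [exact: cvg_fst|exact: continuous_sqnorm].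
have P0 : P (0, xs) by split=> //=; rewrite sqnorm0 ltW.
have phi0 k : (M%:E <= phi k (0%R, xs))%E.
  rewrite /phi /= addr0 sqnorm0 mulr0 subr0 vxs -EFinD lee_fin lerDl.
  by rewrite mulr_ge0 ?sqnorm_ge0// ltW.
have [p1 Pp1 p1max] := usc_max cP (ex_intro _ _ P0) (uphi 0).
have [f1 f1E] : exists f1 : R, phi 0 p1 = f1%:E.
  have := (uphi 0 p1 Pp1).1; have := le_trans (phi0 0) (p1max _ P0).
  by case: (phi 0 p1) => [r _ _|//|//]; exists r.
have Mf1 : M <= f1.
  by rewrite -lee_fin -f1E; exact: le_trans (phi0 0) (p1max _ P0).
(* Here f1 is the maximum without penalty. For |s|^2 = d the penalised value is at most f1 - k d = M
   - d, below the value at (0, xs), which is at least M. *)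
pose k := (f1 - M) / d + 1.
have k0 : 0 < k.
  by rewrite ltr_wpDl//; apply: divr_ge0; [rewrite subr_ge0|exact: ltW].
have kd : f1 - k * d < M.
  have -> : k * d = f1 - M + d by rewrite /k; field; rewrite gt_eqF.
  lra.
have [[s y] [/= sd Ky] pmax] := usc_max cP (ex_intro _ _ P0) (uphi k).
have Mphi : (M%:E <= phi k (s, y))%E by exact: le_trans (phi0 k) (pmax _ P0).
have phi_k : phi k (s, y) = (phi 0%R (s, y) - (k * sqnorm s)%:E)%E.
  by rewrite /phi /= mul0r subr0 EFinB addeA.
have sd' : sqnorm s < d.
  rewrite lt_neqAle sd andbT; apply/eqP => sdE.
  have /p1max : P (s, y) by split.
  rewrite f1E => h; have : (phi k (s, y) <= f1%:E - (k * sqnorm s)%:E)%E.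
    by rewrite phi_k; exact: leeB.
  rewrite sdE -EFinB => h'; have := le_trans Mphi h'.
  by rewrite lee_fin leNgt kd.
have nSy : ~ S y.
  move=> Sy; have := inM y s Sy sd => h.
  have : (phi k (s, y) < M%:E)%E.
    rewrite /phi /= -lteBrDr// -EFinB; apply: lt_le_trans h _; rewrite lee_fin.
    have h1 : e * sqnorm (y + s) <= e * (2 * B + 2 * d)
      by rewrite ler_wpM2l ?(ltW e0)// sqys.
    have h2 : 0 <= k * sqnorm s by rewrite mulr_ge0 ?sqnorm_ge0// ltW.
    have h3 : e * (2 * B + 2 * d) + e <= M - M'
      by rewrite -[X in _ + X]mulr1 -mulrDr.
    move: h1 h2 h3 e0; move: (sqnorm (y + s)) (sqnorm s) => a b; clear; lra.
  by rewrite ltNge Mphi.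
have [C CE] : exists C : R, phi k (s, y) = C%:E.
  have := (uphi k (s, y) (conj sd Ky)).1; move: Mphi.
  by case: (phi k (s, y)) => [r _ _|//|//]; exists r.
apply: (@touching_contra R N q K V v y s e k d C oV qv e0 (ltW k0) sd' (inV _ _
  Ky sd) _ _ (hT _ Ky nSy)).
- move=> y' s' Ky' sd''; rewrite -CE; exact: (pmax (s', y') (conj sd'' Ky')).
- by rewrite -CE.
Qed.

End Doubling.

(** * C^2 functions: composition and sums *)

Section Composition.
Variables (R : realType) (N : nat).
Implicit Types (U : set (Cn R N)) (h g : Cn R N -> R) (z v w : Cn R N).

Lemma near_eq_continuous (f g : Cn R N -> R) z : (\forall y \near z,
  f y = g y) ->
  {for z, continuous f} -> {for z, continuous g}.
Proof.
move=> E cf A nA; have Ez := nbhs_singleton E.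
have fA : \forall y \near z, A (f y) by apply: cf; rewrite Ez.
by rewrite -/(nbhs z _); apply: filterS2 E fA => y /= <-.
Qed.

Section Comp.
Variables (phi phi1 phi2 : R -> R).
Hypotheses (d1 : forall t : R, is_derive t 1 phi (phi1 t))
           (d2 : forall t : R, is_derive t 1 phi1 (phi2 t))
           (c2 : continuous phi2).

Lemma is_derive_comp (f f1 : R -> R) h z v : (forall t : R,
  is_derive t 1 f (f1 t)) ->
  derivable h z v -> is_derive z v (f \o h) (f1 (h z) * 'D_v h z).
Proof.
move=> df hd; apply: derive_of_line.
have L := @is_derive_line _ _ h z v 0; rewrite scale0r add0r in L.
have := df (h (0 *: v + z)); rewrite scale0r add0r => df0.
apply: (@is_derive1_comp R f (fun s => h (s *: v + z)) 0 _ _ _ (L hd)).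
by rewrite scale0r add0r.
Qed.

Lemma derive_comp_near U h v z : open U -> C2_on U h -> U z ->
  \forall y \near z, phi1 (h y) * 'D_v h y = 'D_v (phi \o h) y.
Proof.
move=> oU hC zU; have nU : nbhs z U by exact: open_nbhs_nbhs.
apply: filterS nU => y yU; have [_ /(_ v) [dv _] _] := hC y yU.
by have [_ ->] := is_derive_comp d1 dv.
Qed.

Lemma is_derive2_comp U h z v w : open U -> C2_on U h -> U z ->
  is_derive z w ('D_v (phi \o h))
    (phi2 (h z) * 'D_v h z * 'D_w h z + phi1 (h z) * derive2 h z v w).
Proof.
move=> oU hC zU.
apply: (near_eq_is_derive (derive_comp_near v oU hC zU)).
have [_ D1 D2'] := hC z zU.
have [dw _] := D1 w; have [dvw _] := D2' v w.
have dphi : is_derive z w (phi1 \o h) (phi2 (h z) * 'D_w h z) := is_derive_comp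
  d2 dw.
have dD : is_derive z w ('D_v h) (derive2 h z v w) by rewrite derive2E;
  exact: derivableP.
have := is_deriveM dphi dD.
have -> : (phi1 \o h) * ('D_v h) = (fun y => phi1 (h y) * 'D_v h y) by [].
move=> H; apply: is_derive_eq H _; rewrite /GRing.scale /=.
move: (phi1 (h z)) (phi2 (h z)) ('D_v h z) ('D_w h z) (derive2 h z v w) =>
  ? ? ? ? ?.
ring.
Qed.

Lemma continuous_of_derive (f f1 : R -> R) : (forall t : R,
  is_derive t 1 f (f1 t)) ->
  continuous f.
Proof.
by move=> df t; apply/differentiable_continuous/derivable1_diffP;
  have [] := df t.
Qed.

Lemma C2_comp U h : open U -> C2_on U h -> C2_on U (phi \o h).
Proof.
move=> oU hC z zU; have [hz D1 D2'] := hC z zU.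
have nU : nbhs z U by exact: open_nbhs_nbhs.
have cphi1 := continuous_of_derive d2.
split.
- by apply: continuous_comp => //; exact: (continuous_of_derive d1).
- move=> v; have [dv cv] := D1 v; split; first
  by have [] := is_derive_comp d1 dv.
  apply: (near_eq_continuous (derive_comp_near v oU hC zU)).
  by apply: cvgM => //; apply: continuous_comp => //; exact: cphi1.
move=> v w; split; first by have [] := is_derive2_comp v w oU hC zU.
have [_ cv] := D1 v; have [_ cw] := D1 w; have [_ cvw] := D2' v w.
have H : \forall y \near z, phi2 (h y) * 'D_v h y * 'D_w h y + phi1 (h y) *
  'D_w ('D_v h) y =
    'D_w ('D_v (phi \o h)) y.
  by apply: filterS nU => y yU; have [_ ->] := is_derive2_comp v w oU hC yU.
apply: (near_eq_continuous H).
have c1 : {for z, continuous (phi1 \o h)} by apply: continuous_comp => //;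
  exact: cphi1.
have c2' : {for z, continuous (phi2 \o h)} by apply: continuous_comp => //;
  exact: c2.
apply: cvgD; last exact: (cvgM c1 cvw).
exact: (cvgM (cvgM c2' cv) cw).
Qed.

Lemma levi4_comp U h z v : open U -> C2_on U h -> U z ->
  levi4 (phi \o h) z v = phi2 (h z) * ('D_v h z ^+ 2 + 'D_(mulI v) h z ^+ 2) +
    phi1 (h z) * levi4 h z v.
Proof.
move=> oU hC zU; rewrite /levi4 ![derive2 (phi \o h) _ _ _]derive2E.
have [_ ->] := is_derive2_comp v v oU hC zU.
have [_ ->] := is_derive2_comp (mulI v) (mulI v) oU hC zU.
move: ('D_v h z) ('D_(mulI v) h z) (derive2 h z v v) (derive2 h z (mulI v)
  (mulI v)) => ? ? ? ?.
ring.
Qed.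

End Comp.

Lemma C2_add U h g : open U -> C2_on U h -> C2_on U g -> C2_on U (fun z =>
  h z + g z).
Proof.
move=> oU hC gC z zU; have [hz H1 H2] := hC z zU; have [gz G1 G2] := gC z zU.
have nU : nbhs z U by exact: open_nbhs_nbhs.
have E v y : U y -> 'D_v h y + 'D_v g y = 'D_v (fun z => h z + g z) y.
  move=> yU; have [_ /(_ v) [hd _] _] := hC y yU;
    have [_ /(_ v) [gd _] _] := gC y yU.
  by have [_ ->] := is_deriveD (derivableP hd) (derivableP gd).
have nE v : \forall y \near z, 'D_v h y + 'D_v g y = 'D_v (fun z =>
  h z + g z) y.
  by apply: filterS nU => y; exact: E.
have E2 v w y : U y -> is_derive y w ('D_v (fun z => h z + g z))
     ('D_w ('D_v h) y + 'D_w ('D_v g) y).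
  move=> yU; have nUy : nbhs y U by exact: open_nbhs_nbhs.
  have [_ _ /(_ v w) [hd _]] := hC y yU; have [_ _ /(_ v w) [gd _]] := gC y yU.
  apply: (near_eq_is_derive _ (is_deriveD (derivableP hd) (derivableP gd))).
  by apply: filterS nUy => x; exact: E.
split; first exact: cvgD.
  move=> v; split.
    by have [] := is_deriveD (derivableP (H1 v).1) (derivableP (G1 v).1).
  apply: (near_eq_continuous (nE v)); apply: cvgD;
    [exact: (H1 v).2|exact: (G1 v).2].
move=> v w; split; first by have [] := E2 v w z zU.
have nE2 : \forall y \near z, 'D_w ('D_v h) y + 'D_w ('D_v g) y =
    'D_w ('D_v (fun z => h z + g z)) y.
  by apply: filterS nU => y yU; have [_ ->] := E2 v w y yU.
apply: (near_eq_continuous nE2); apply: cvgD;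
  [exact: (H2 v w).2|exact: (G2 v w).2].
Qed.

Lemma levi4_add U h g z v : open U -> C2_on U h -> C2_on U g -> U z ->
  levi4 (fun z => h z + g z) z v = levi4 h z v + levi4 g z v.
Proof.
move=> oU hC gC zU.
have E w : derive2 (fun z => h z + g z) z w w = derive2 h z w w + derive2 g z w
  w.
  have nU : nbhs z U by exact: open_nbhs_nbhs.
  have [_ _ /(_ w w) [hd _]] := hC z zU; have [_ _ /(_ w w) [gd _]] := gC z zU.
  rewrite derive2E; have [_ <-] := is_deriveD (derivableP hd) (derivableP gd).
  apply: near_eq_derive; apply: filterS nU => y yU.
  have [_ /(_ w) [hdy _] _] := hC y yU; have [_ /(_ w) [gdy _] _] := gC y yU.
  by have [_ ->] := is_deriveD (derivableP hdy) (derivableP gdy).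
rewrite /levi4 !E; move: (derive2 h z v v) (derive2 h z (mulI v) (mulI v))
  (derive2 g z v v) (derive2 g z (mulI v) (mulI v)).
by move=> a b c d; rewrite addrACA.
Qed.

End Composition.

(** * Points that are not strictly q-pseudoconvex *)

Section BoundaryPoints.
Variables (R : realType) (N : nat).
Implicit Types (D U : set (Cn R N)) (h rho : Cn R N -> R) (y z v : Cn R N).
Local Open Scope complex_scope.

Lemma mulID v w : mulI (v + w) = mulI v + mulI w :> Cn R N.
Proof. by congr pair; rewrite opprD. Qed.

Lemma mulIZ (a : R) v : mulI (a *: v) = a *: mulI v :> Cn R N.
Proof. by congr pair; rewrite scalerN. Qed.

Lemma unitary_exists q : (q < N)%N -> exists A : 'M[R[i]]_(q.+1, N),
  A \is unitarymx.
Proof.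
move=> qN; exists (rowsub (widen_ord qN) 1%:M).
apply: rowsub_unitary; first by move=> i j /(congr1 val) /= /val_inj.
by apply/unitarymxP; rewrite trmx1 map_mx1 mulmx1.
Qed.

Lemma near0_bent_plane k (A : 'M[R[i]]_(k, N)) (th : Cn R k ->
  R) (nu : Cn R N) (T : R)
    (P : set (Cn R N)) : A \is unitarymx ->
      (forall w, `|th w| <= T * sqnorm w) ->
  nbhs (0 : Cn R N) P -> \forall w \near (0 : Cn R k),
    P (plane_map A w - th w *: nu).
Proof.
move=> uA hT /near0_sqnormP[r r0 hr].
(* For |w| <= 1 one has th(w)^2 <= T^2 |w|^2, so [sqnormD_le] bounds the squared length of the bent
   vector by a |w|^2. *)
pose a := 2 + 2 * T ^+ 2 * sqnorm nu.
have a0 : 0 < a.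
  have := mulr_ge0 (sqr_ge0 T) (sqnorm_ge0 nu); rewrite /a;
    move: (T ^+ 2) (sqnorm nu) => t s.
  by nra.
apply/near0_sqnormP; exists (Num.min 1 (r / a)).
  by rewrite lt_min ltr01 divr_gt0.
move=> w; rewrite le_min => /andP[w1 wr]; apply: hr.
apply: le_trans (sqnormD_le _ _) _; rewrite sqnormN sqnormZ sqnorm_plane_map//.
have w0 := sqnorm_ge0 w.
have th2 : th w ^+ 2 <= T ^+ 2 * sqnorm w.
  rewrite -real_normK ?num_real//.
  have h1 := hT w; have h2 := normr_ge0 (th w).
  apply: le_trans (_ : (T * sqnorm w) ^+ 2 <= _).
    by rewrite ler_sqr// ?nnegrE// (le_trans h2).
  by rewrite exprMn ler_wpM2l ?sqr_ge0// expr2 ler_piMr.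
apply: le_trans (_ : a * sqnorm w <= _); last by rewrite mulrC -ler_pdivlMr.
have := ler_wpM2r (sqnorm_ge0 nu) th2; rewrite /a.
move: (sqnorm w) (sqnorm nu) (th w ^+ 2) (T ^+ 2) => s n t T2; lra.
Qed.

Lemma touchable_interior q D y : (q < N)%N -> open D -> D y ->
  touchable q (closure D) y.
Proof.
move=> qN oD Dy; have [A uA] := unitary_exists qN.
exists A, (fun _ _ => 0), 0; split => //.
- by move=> u; split=> *; rewrite ?addr0 ?mulr0.
- by move=> u v; rewrite oppr0.
move=> eta eta0.
have nD : nbhs (0 : Cn R N) [set v | D (y + v)].
  have /nbhs_sqnormP[r r0 hr] : nbhs y D by exact: open_nbhs_nbhs.
  apply/near0_sqnormP; exists r => // v vr; apply: hr.
  by rewrite addrAC subrr add0r.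
have := @near0_bent_plane _ A (fun=> 0) 0 0 _ uA _ nD.
have H : forall w : Cn R q.+1, `|0 : R| <= 0 * sqnorm w by move=> w;
  rewrite normr0 mul0r.
move=> /(_ H); apply: filterS => w; rewrite /= scaler0 subr0 => Dw.
by rewrite scaler0 subr0; exact: subset_closure.
Qed.

Lemma defining_zero D y U rho : open D -> bd D y -> C2_defining D y U rho ->
  rho y = 0.
Proof.
move=> oD [cD nD] [oU yU rC _ UD]; rewrite (interior_id _).1// in nD.
have [ry _ _] := rC y yU.
have nU : nbhs y U by exact: open_nbhs_nbhs.
apply/eqP; rewrite eq_le; apply/andP; split; rewrite leNgt; apply/negP => h0.
  have n0 : \forall z \near y, 0 < rho z.
    by apply: (ry [set t | 0 < t]); exact: lt_nbhsr.
  have [z [Dz [Uz rz]]] := cD _ (filterI nU n0).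
  have : (U `&` D) z by [].
  by rewrite UD => -[_ rz']; have := lt_trans rz rz'; rewrite ltxx.
by apply: nD; have : (U `&` D) y; [rewrite UD|case].
Qed.

Lemma touchable_tangent q D y U rho v0 (A : 'M[R[i]]_(q.+1, N)) :
  open D -> bd D y -> open U -> U y -> C2_on U rho -> rho y = 0 ->
  U `&` D = [set z | U z /\ rho z < 0] -> 'D_v0 rho y != 0 ->
  A \is unitarymx -> (forall w, 'D_(plane_map A w) rho y = 0) ->
  (forall w, levi4 rho y (plane_map A w) <= 0) ->
  touchable q (closure D) y.
Proof.
move=> oD [cD _] oU yU rC ry UD dv0 uA Atan Alev.
have l1 := C1_near_lin (C2_C1_near oU rC yU).
have lr u := derive2_linr u oU rC yU.
have ll u := derive2_linl u oU rC yU.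
have ls u v := derive2_sym u v oU rC yU.
pose b (u w : Cn R q.+1) := (derive2 rho y (plane_map A u) (plane_map A w) -
   derive2 rho y (mulI (plane_map A u)) (mulI (plane_map A w))) / 4.
pose nu := ('D_v0 rho y)^-1 *: v0.
have br u : lin_fun (b u).
  split=> [v w|a v].
    rewrite /b plane_mapD mulID !(lr _).1.
    move: (derive2 _ _ _ _) (derive2 _ _ _ _) (derive2 _ _ _ _) (derive2 _ _ _
      _) => ? ? ? ?; by field.
  rewrite /b plane_mapZ mulIZ !(lr _).2.
  move: (derive2 _ _ _ _) (derive2 _ _ _ _) => ? ?; by field.
have bs u w : b u w = b w u.
  by rewrite /b (ls (plane_map A u)) (ls (mulI (plane_map A u))).
exists A, b, nu; split => //.
  move=> u w; rewrite /b !plane_map_mulI !mulIK.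
  rewrite (lin_funN _ (ll (- plane_map A w))) (lin_funN _ (lr (plane_map A u)))
    opprK.
  by rewrite -mulNr opprB.
move=> eta eta0.
have bl u : lin_fun (b^~ u).
  by have -> : b^~ u = b u by [apply/funext => w; rewrite bs]; exact: br.
have [M M0 hM] := quad_bound br bl.
pose T := M + eta.
have T0 : 0 < T by rewrite ltr_wpDl.
pose th w := b w w + eta * sqnorm w.
have hT w : `|th w| <= T * sqnorm w.
  apply: le_trans (ler_normD _ _) _; rewrite mulrDl lerD// ger0_norm//.
  by rewrite mulr_ge0 ?sqnorm_ge0// ltW.
(* Three errors are each kept below eta/8 |w|^2: the mixed term th w * m w, the theta^2 terms
   collected in c2, and the part of the Taylor remainder coming from 2 |w|^2. *)
have k0 : 0 < eta / 16 by rewrite divr_gt0.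
have nT := taylor2 oU rC yU k0.
have nU : nbhs (0 : Cn R N) [set v | U (y + v)].
  have /nbhs_sqnormP[r r0 hr] : nbhs y U by exact: open_nbhs_nbhs.
  apply/near0_sqnormP; exists r => // v vr; apply: hr.
  by rewrite addrAC subrr add0r.
have nUT : nbhs (0 : Cn R N) ([set v | U (y + v)] `&` [set v |
    `|rho (y + v) - rho y - 'D_v rho y - derive2 rho y v v / 2| <= eta / 16 *
      sqnorm v]).
  exact: filterI.
have n1 := near0_bent_plane nu uA hT nUT.
pose m (w : Cn R q.+1) := derive2 rho y (plane_map A w) nu.
have lm : lin_fun m by exact: (lin_plane_map A (ll nu)).
have k1 : 0 < eta / 8 / T by rewrite divr_gt0// divr_gt0.
have n2 : \forall w \near (0 : Cn R q.+1), `|m w| <= eta / 8 / T.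
  have := continuous_near (continuous_lin lm (x := 0)) k1.
  by apply: filterS => w; rewrite (lin_fun0 lm) subr0.
pose c2 := `|derive2 rho y nu nu| / 2 + 2 * (eta / 16) * sqnorm nu.
have c20 : 0 <= c2 by rewrite addr_ge0// !mulr_ge0 ?sqnorm_ge0// ltW.
have n3 : \forall w \near (0 : Cn R q.+1), sqnorm w <= eta / 8 / (T ^+ 2 * c2 +
  1).
  apply/near0_sqnormP; exists (eta / 8 / (T ^+ 2 * c2 + 1)) => //.
  by rewrite !divr_gt0// ltr_wpDl// mulr_ge0// exprn_ge0// ltW.
apply: filterS3 n1 n2 n3 => w [/= Uw Tw] mw sw.
rewrite -/(th w) -addrA.
(* At w = 0 the bent point is y itself, which lies in the closure of D but not in D. *)
have [->|w0] := eqVneq w 0.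
  have -> : th 0 = 0.
    by rewrite /th sqnorm0 mulr0 addr0; exact: lin_fun0 (br 0).
  by rewrite plane_map0 scale0r subr0 addr0.
have sw0 := sqnorm_gt0 w0.
apply: subset_closure.
suff : (U `&` D) (y + (plane_map A w - th w *: nu)) by case.
rewrite UD; split => //.
have Dnu : 'D_nu rho y = 1 by rewrite /nu l1.2 mulVf.
have D1E : 'D_(plane_map A w - th w *: nu) rho y = - th w.
  by rewrite l1.1 Atan add0r (lin_funN _ l1) l1.2 Dnu mulr1.
have D2w : derive2 rho y (plane_map A w - th w *: nu) (plane_map A w - th w *:
  nu) =
   derive2 rho y (plane_map A w) (plane_map A w) - 2 * th w * m w + th w ^+ 2 *
     derive2 rho y nu nu.
  have rB u : derive2 rho y u (plane_map A w - th w *: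
    nu) = derive2 rho y u (plane_map A w) - th w * derive2 rho y u nu.
    by rewrite (lr u).1 (lin_funN _ (lr u)) (lr u).2.
  have lB u : derive2 rho y (plane_map A w - th w *:
    nu) u = derive2 rho y (plane_map A w) u - th w * derive2 rho y nu u.
    by rewrite (ll u).1 (lin_funN _ (ll u)) (ll u).2.
  rewrite lB !rB (ls nu (plane_map A w)) -/(m w).
  move: (derive2 _ _ _ _) (derive2 _ _ _ _) (m w) (th w) => ? ? ? ?; ring.
have levE : derive2 rho y (plane_map A w) (plane_map A w) / 2 = b w w + levi4
  rho y (plane_map A w) / 4.
  by rewrite /b /levi4; move: (derive2 _ _ _ _) (derive2 _ _ _ _) => ? ?; field.
have sqle := sqnormD_le (plane_map A w) (- (th w *: nu)).
rewrite sqnormN sqnormZ sqnorm_plane_map// in sqle.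
move: Tw; rewrite ry D1E D2w ler_norml => /andP[_].
have thw := hT w.
have e1 : `|th w * m w| <= eta / 8 * sqnorm w.
  rewrite normrM; apply: le_trans (ler_pM _ _ thw mw) _ => //.
  by rewrite le_eqVlt; apply/orP; left; apply/eqP; field; rewrite gt_eqF.
have e2 : th w ^+ 2 * c2 <= eta / 8 * sqnorm w.
  have th2 : th w ^+ 2 <= T ^+ 2 * sqnorm w ^+ 2.
    rewrite -exprMn -real_normK ?num_real// ler_sqr ?nnegrE//.
    by rewrite mulr_ge0 ?sqnorm_ge0// ltW.
  apply: le_trans (ler_wpM2r c20 th2) _.
  rewrite mulrAC expr2 mulrA; apply: ler_wpM2r; first exact: ltW.
  apply: le_trans (ler_wpM2l _ sw) _; first by rewrite mulr_ge0 ?sqr_ge0.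
  rewrite mulrCA ler_piMr//; first by rewrite divr_ge0// ltW.
  rewrite ler_pdivrMr ?mul1r ?lerDl//.
  by rewrite ltr_wpDl// mulr_ge0 ?sqr_ge0.
have e3 := ler_wpM2l (ltW k0) sqle.
have e4 : th w ^+ 2 * derive2 rho y nu nu <= th w ^+ 2 * `|derive2 rho y nu nu|.
  by rewrite ler_wpM2l ?sqr_ge0// ler_norm.
have := Alev w; move: e1 e2 e3 e4 levE; rewrite /c2 ler_norml => /andP[e1 _].
rewrite [in - th w]/th.
move: (rho _) (sqnorm (plane_map A w - _)) (derive2 rho y (plane_map A w)
  (plane_map A w)) (levi4 _ _ _).
move: `|derive2 rho y nu nu| (derive2 rho y nu nu) (sqnorm nu) =>
  q1 q2 q3 q4 q5 q6 q7 e2 e3 e4 levE q70.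
have : eta * sqnorm w > 0 by rewrite mulr_gt0.
have thE : th w = b w w + eta * sqnorm w by [].
move: (th w) (b w w) (m w) (sqnorm w) thE e1 e2 e3 e4 levE =>
  x1 x2 x3 x4 thE e1 e2 e3 e4 levE.
move: `|q2| e2 e4 => a2 e2 e4; clear -e1 e2 e3 e4 levE q70.
lra.
Qed.

(** The column of the 2 d rho / dz_j; its left kernel is the complex tangent space of the level set
    of rho. *)
Definition cgrad rho y : 'cV[R[i]]_N :=
  \col_j ('D_(dirx R j) rho y -i* 'D_(diry R j) rho y).

Lemma lin_fun_split (l : Cn R N -> R) v : lin_fun l ->
  l v = \sum_j (v.1 0 j * l (dirx R j) + v.2 0 j * l (diry R j)).
Proof.
move=> hl; rewrite (lin_fun_sum v hl) big_sumType /= -big_split /=.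
by apply: eq_bigr => j _; rewrite !(ord1 ord0).
Qed.

Lemma cgradE U rho y v : open U -> C2_on U rho -> U y ->
  (toC v *m cgrad rho y) 0 0 = ('D_v rho y) -i* ('D_(mulI v) rho y).
Proof.
move=> oU rC yU; have l1 := C1_near_lin (C2_C1_near oU rC yU).
rewrite (lin_fun_split v l1) (lin_fun_split (mulI v) l1) mxE.
have sumC (F G : 'I_N -> R) : \sum_j (F j -i* G j) = (\sum_j F j) -i* (\sum_j G
  j).
  by rewrite -sumrN; elim/big_rec3 : _ => // j a b c _ ->; simpc.
rewrite -sumC; apply: eq_bigr => j _; rewrite !mxE.
move: (v.1 _ _) (v.2 _ _) ('D_(dirx R j) rho y) ('D_(diry R j) rho y) =>
  x x' d d'; simpc.
by rewrite [- _ + _]addrC.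
Qed.

(* If no plane as in touchable_tangent exists, then rho + 2 c rho^2 is a
   strictly q-plurisubharmonic defining function for some c. *)
Lemma touchable_boundary q D y U rho : (q < N)%N ->
  open D -> bd D y -> C2_defining D y U rho ->
  ~ strictly_qpseudoconvex_at q D y -> touchable q (closure D) y.
Proof.
move=> qN oD bDy hdef nS; have ry := defining_zero oD bDy hdef.
have [oU yU rC [v0 dv0] UD] := hdef.
rewrite (diff_derive v0 oU rC yU) in dv0.
have hH := cplx_hessian_herm oU rC yU.
have a0 : cgrad rho y != 0.
  apply: contra dv0 => /eqP g0; have := cgradE v0 oU rC yU.
  by rewrite g0 mulmx0 mxE => -[<- _].
have kE : (N - q.+1 + 1 + q = N)%N by lia.
have [[A [uA Aa Ah]]|[B [c [l [cR l0 hB]]]]] := tangent_alternative hH a0 kE.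
  apply: (touchable_tangent oD bDy oU yU rC ry UD dv0 uA).
    move=> w; have := cgradE (plane_map A w) oU rC yU.
    by rewrite /plane_map ofCK -mulmxA Aa mulmx0 mxE => -[<- _].
  move=> w; have := Ah (toC w); rewrite (levi4_plane_map_hform _ _ oU rC yU).
  by rewrite (_ : 0 = 0%:C)// lecR pmulr_lle0 ?invr_gt0.
exfalso; apply: nS.
have {cR}cE : c = (complex.Re c)%:C by rewrite RRe_real.
have lE : l = (complex.Re l)%:C by rewrite RRe_real// gtr0_real.
move: hB l0; rewrite cE lE; move: (complex.Re c) (complex.Re l) =>
  {cE lE}c {}l hB l0.
rewrite (_ : 0 = 0%:C)// ltcR in l0.
(* At 0 this has first derivative 1 and second derivative 4 c; the 4 matches the factor between
   [levi4] and [hform], so the alternative's c |u a|^2 appears exactly. *)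
pose phi (t : R) := t + 2 * c * t ^+ 2.
pose phi1 (t : R) := 1 + 4 * c * t.
pose phi2 (t : R) := 4 * c.
have d1 (t : R) : is_derive t 1 phi (phi1 t).
  rewrite /phi; apply: is_derive_eq. rewrite /phi1 ?scaler0 /GRing.scale /=.
    ring.
have d2 (t : R) : is_derive t 1 phi1 (phi2 t).
  rewrite /phi1; apply: is_derive_eq; rewrite /phi2 ?scaler0 /GRing.scale /=.
    ring.
have c2 : continuous phi2 by move=> t; exact: cvg_cst.
have gC := C2_comp d1 d2 c2 oU rC.
have glev v : levi4 (phi \o rho) y v = levi4 rho y v + 4 * c * ('D_v rho y ^+ 2
  + 'D_(mulI v) rho y ^+ 2).
  rewrite (levi4_comp d1 d2 _ oU rC yU) ry /phi1 /phi2 mulr0 addr0 mul1r.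
  by rewrite addrC.
have gB w : 4 * l * sqnorm w <= levi4 (phi \o rho) y (plane_map B w).
  have := hB (toC w); rewrite (levi4_plane_map_hform _ _ oU rC yU) csqnorm_toC.
  have := cgradE (plane_map B w) oU rC yU; rewrite {1}/plane_map ofCK => ->.
  rewrite -add_Re2_Im2 /= sqrrN -!rmorphM -rmorphD /= lecR glev.
  move: (sqnorm w) (levi4 _ _ _) ('D_(plane_map B w) rho y ^+ 2) ('D_(mulI
    (plane_map B w)) rho y ^+ 2).
  move=> s t a b; lra.
have l4 : 0 < 4 * l by rewrite mulr_gt0.
have := pos_eigenvalues_of_frame oU gC yU l4 gB.
have -> : (N - q.+1 + 1 = N - q)%N by lia.
move=> /(pos_eigenvalues_near oU gC yU)[P [l' [uP l'0 nP]]].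
have [ry0 _ _] := rC y yU.
have nr : \forall z \near y, 0 < 1 + 2 * c * rho z.
  have cr : {for y, continuous (fun z => 1 + 2 * c * rho z)}.
    by apply: cvgD; [exact: cvg_cst|apply: cvgM; [exact: cvg_cst|exact: ry0]].
  by apply: (cr [set t | 0 < t]); apply: lt_nbhsr; rewrite ry mulr0 addr0.
have nU : nbhs y U by exact: open_nbhs_nbhs.
(* Positivity on a fixed frame gives the eigenvalue count on a whole neighbourhood. Since phi(rho) =
   rho (1 + 2 c rho), positivity of the second factor makes the new function define the same set
   D. *)
pose W := [set z | [/\ U z, (forall w, l' * sqnorm w <= levi4 (phi \o rho) z
  (plane_map P w)) &
   0 < 1 + 2 * c * rho z]].
have nW : nbhs y W by apply: filterS3 nU nP nr => z *; split.
have WU : interior W `<=` U by move=> z /interior_subset[].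
exists (interior W), (phi \o rho); split.
  split.
  - exact: open_interior.
  - exact: nW.
  - exact: C2_sub WU gC.
  - exists v0; rewrite (diff_derive v0 oU gC yU).
    have [_ /(_ v0) [dv _] _] := rC y yU.
    have [_ ->] := is_derive_comp d1 dv.
    by rewrite ry /phi1 mulr0 addr0 mul1r.
  - rewrite eqEsubset; split=> z.
      move=> [Wz Dz]; split=> //; have [Uz _ pz] := interior_subset Wz.
      have : (U `&` D) z by []. rewrite UD => -[_ rz].
      rewrite /= /phi expr2 mulrA -[X in X + _]mul1r -mulrDl.
      by rewrite pmulr_rlt0.
    move=> [Wz gz]; split=> //; have [Uz _ pz] := interior_subset Wz.
    suff : (U `&` D) z by case.
    rewrite UD; split=> //.
    move: gz; rewrite /= /phi expr2 mulrA -[X in X + _]mul1r -mulrDl.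
    by rewrite pmulr_rlt0.
split; first exact: C2_sub WU gC.
move=> z Wz; have [Uz Pz _] := interior_subset Wz.
exact: (pos_eigenvalues_of_frame oU gC Uz l'0 Pz).
Qed.

End BoundaryPoints.

(** * Peak functions *)

Section PositivePartPower.
Variable R : realType.

(** At 0 the difference quotient vanishes on the left and equals h^(n+1) on the right. Applied
    twice, starting from the cube, this gives the C^2 cutoff of [peak_function]. *)
Lemma is_derive_max0X n (t : R) :
  is_derive t 1 (fun t : R => Num.max t 0 ^+ n.+2) (n.+2%:R * Num.max t 0 ^+
    n.+1).
Proof.
have [t0|t0|->] := ltgtP t 0.
- rewrite expr0n /= mulr0.
  apply: (@near_eq_is_derive _ _ _ (fun=> 0 : R)).
  near=> s; rewrite (max_idPr _) ?expr0n// ltW//.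
  by near: s; exact: lt_nbhsl.
- apply: (@near_eq_is_derive _ _ _ (fun s : R => s ^+ n.+2)).
    near=> s; rewrite (max_idPl _)// ltW//.
    by near: s; exact: lt_nbhsr.
  by split; [exact: exprn_derivable|rewrite exp_derive /GRing.scale /= mulr1].
rewrite expr0n /= mulr0.
have H : (fun h : R => h^-1 *: (((fun t : R =>
  Num.max t 0 ^+ n.+2) \o shift 0) (h *: 1) -
    Num.max 0 0 ^+ n.+2)) @ 0^' --> (0 : R).
  apply/cvgrPdist_lt => e e0.
  have : \forall h \near (0 : R)^', `|h| < Num.min e 1.
    by apply: dnbhs0_lt; rewrite lt_min e0 ltr01.
  apply: filterS => h; rewrite lt_min => /andP[he h1].
  rewrite sub0r normrN /= addr0 [_%:A]mulr1 maxxx expr0n /= subr0.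
  have [h0|h0] := leP h 0.
    by rewrite expr0n /= scaler0 normr0.
  rewrite exprS /GRing.scale /= mulrA mulVf ?gt_eqF// mul1r.
  rewrite gtr0_norm ?exprn_gt0//; rewrite (gtr0_norm h0) in he h1.
  apply: le_lt_trans he; rewrite exprS ler_piMr ?(ltW h0)// exprn_ile1// ltW//.
split; first by apply/cvg_ex; exists 0.
exact: cvg_lim H.
Unshelve. all: by end_near. Qed.

Lemma max0X_continuous n : continuous (fun t : R => Num.max t 0 ^+ n.+1).
Proof.
move=> t.
apply: (@continuous_comp _ _ _ (fun t : R => Num.max t 0) (fun x : R =>
  x ^+ n.+1)); last exact: exprn_continuous.
by apply: continuous_max; [exact: cvg_id|exact: cvg_cst].
Qed.

End PositivePartPower.

Section Peak.
Variables (R : realType) (N : nat).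
Implicit Types (D U V : set (Cn R N)) (g h rho : Cn R N ->
  R) (p y z v : Cn R N).

(** Serves a function defined by cases: on each of two open sets it agrees with a function whose
    derivatives are known. *)
Lemma C2_levi4_eq U g h : open U -> C2_on U h -> (forall y, U y -> h y = g y) ->
  C2_on U g /\ forall z v, U z -> levi4 g z v = levi4 h z v.
Proof.
move=> oU hC E.
have nE z : U z -> \forall y \near z, h y = g y.
  by move=> zU; have nU : nbhs z U by [exact: open_nbhs_nbhs];
    apply: filterS nU.
have D1 v z : U z -> is_derive z v g ('D_v h z).
  move=> zU; apply: near_eq_is_derive (nE z zU) _; apply: derivableP.
  by have [_ /(_ v) []] := hC z zU.
have nD1 v z : U z -> \forall y \near z, 'D_v h y = 'D_v g y.
  move=> zU; have nU : nbhs z U by exact: open_nbhs_nbhs.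
  by apply: filterS nU => y yU; have [_ ->] := D1 v y yU.
have D2' v w z : U z -> is_derive z w ('D_v g) ('D_w ('D_v h) z).
  move=> zU; apply: near_eq_is_derive (nD1 v z zU) _; apply: derivableP.
  by have [_ _ /(_ v w) []] := hC z zU.
have nD2 v w z : U z -> \forall y \near z, 'D_w ('D_v h) y = 'D_w ('D_v g) y.
  move=> zU; have nU : nbhs z U by exact: open_nbhs_nbhs.
  by apply: filterS nU => y yU; have [_ ->] := D2' v w y yU.
split=> [z zU|z v zU].
  have [h0 h1 h2] := hC z zU; split.
  - exact: near_eq_continuous (nE z zU) h0.
  - move=> v; split; first by have [] := D1 v z zU.
    exact: near_eq_continuous (nD1 v z zU) (h1 v).2.
  move=> v w; split; first by have [] := D2' v w z zU.
  exact: near_eq_continuous (nD2 v w z zU) (h2 v w).2.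
have E2 w : derive2 g z w w = derive2 h z w w by rewrite !derive2E;
  have [_ ->] := D2' w w z zU.
by rewrite /levi4 !E2.
Qed.

Lemma defining_le0 D y U rho : open U -> C2_on U rho ->
  U `&` D = [set z | U z /\ rho z < 0] -> closure D y -> U y -> rho y <= 0.
Proof.
move=> oU rC UD cD yU; rewrite leNgt; apply/negP => h0.
have [ry _ _] := rC y yU.
have nU : nbhs y U by exact: open_nbhs_nbhs.
have n0 : \forall z \near y, 0 < rho z.
  by apply: (ry [set t | 0 < t]); exact: lt_nbhsr.
have [z [Dz [Uz rz]]] := cD _ (filterI nU n0).
have : (U `&` D) z by [].
by rewrite UD => -[_ rz']; have := lt_trans rz rz'; rewrite ltxx.
Qed.

Definition paraboloid (c e : R) p z : R := c - e * sqnorm (z - p).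

Lemma rdotC v z : rdot v z = rdot z v.
Proof. by apply: eq_bigr => i _; rewrite mulrC. Qed.

Lemma paraboloid_C2 U c e p : open U -> C2_on U (paraboloid c e p) /\
  forall z v, U z -> levi4 (paraboloid c e p) z v = - (4 * e * sqnorm v).
Proof.
move=> oU.
pose l v := 2 * e * rdot p v.
pose b v w := - e * rdot v w.
have hl : lin_fun l by split=> *; rewrite /l ?rdotDr ?rdotZr; ring.
have br u : lin_fun (b u) by split=> *; rewrite /b ?rdotDr ?rdotZr; ring.
have bs u v : b u v = b v u by rewrite /b rdotC.
(* The paraboloid is not pluriharmonic, but it is a [quadpoly], whose derivatives are already
   computed. *)
have E : paraboloid c e p = quadpoly (c - e * sqnorm p) l b.
  apply/funext => z; rewrite /paraboloid /quadpoly /l /b sqnormD sqnormN.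
  have -> : rdot z (- p) = - rdot p z.
    by rewrite -scaleN1r rdotZr mulN1r rdotC.
  have -> : sqnorm z = rdot z z by apply: eq_bigr => i _; rewrite expr2.
  move: (rdot z z) (rdot p z) (sqnorm p) => ? ? ?; ring.
rewrite E; split; first exact: quadpoly_C2.
move=> z v _.
have D2q w : derive2 (quadpoly (c - e * sqnorm p) l b) z w w = 2 * b w w.
  by rewrite derive2E; have [_ ->] := is_derive_derive_quadpoly (c - e * sqnorm
    p) hl br bs z w w.
rewrite /levi4 !D2q /b.
have -> : rdot v v = sqnorm v by apply: eq_bigr => i _; rewrite expr2.
have -> : rdot (mulI v) (mulI v) = sqnorm v.
  by rewrite -(sqnorm_mulI v); apply: eq_bigr => i _; rewrite expr2.
move: (sqnorm v) => ?; ring.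
Qed.

Lemma const_C2 U (c : R) : C2_on U (fun=> c) /\ forall z v,
  levi4 (fun=> c) z v = 0.
Proof.
have D0 v : 'D_v (fun=> c) = (fun=> 0) :> (Cn R N -> R).
  by apply/funext => z; exact: derive_cst.
have D00 v w z : 'D_w ('D_v (fun=> c)) z = 0 :> R by rewrite D0;
  exact: derive_cst.
split=> [z _|z v]; last by rewrite /levi4 !derive2E !D00 addr0.
split; first exact: cvg_cst.
  by move=> v; split; [exact: derivable_cst|rewrite D0; exact: cvg_cst].
move=> v w; rewrite D0; split; first exact: derivable_cst.
have -> : 'D_w (fun=> 0) = (fun=> 0) :> (Cn R N -> R).
  by apply/funext => y; exact: derive_cst.
exact: cvg_cst.
Qed.

End Peak.

Section PeakFunction.
Variables (R : realType) (N : nat).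
Implicit Types (D U V K S : set (Cn R N)) (g h rho : Cn R N ->
  R) (p y z v : Cn R N).

Lemma open_sqnorm_lt p (r : R) : open [set z : Cn R N | sqnorm (z - p) < r].
Proof.
have cs : continuous (fun z : Cn R N => sqnorm (z - p)).
  move=> z; apply: continuous_comp; last exact: continuous_sqnorm.
  by apply: cvgB; [exact: cvg_id|exact: cvg_cst].
by apply: (open_comp (D := [set t | t < r])); [move=> z _;
  exact: cs|exact: open_lt].
Qed.

Lemma open_sqnorm_gt p (r : R) : open [set z : Cn R N | r < sqnorm (z - p)].
Proof.
have cs : continuous (fun z : Cn R N => sqnorm (z - p)).
  move=> z; apply: continuous_comp; last exact: continuous_sqnorm.
  by apply: cvgB; [exact: cvg_id|exact: cvg_cst].
by apply: (open_comp (D := [set t | r < t])); [move=> z _;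
  exact: cs|exact: open_gt].
Qed.

Lemma dirx_neq0 k : dirx R (ord0 : 'I_k.+1) != 0 :> Cn R k.+1.
Proof.
apply/eqP => /(congr1 (fun v : Cn R k.+1 => rcoord v (inl ord0))).
rewrite (rcoord_rbasis R (inl ord0) (inl ord0)) eqxx /rcoord /= mxE => /eqP.
by rewrite oner_eq0.
Qed.

(* With phi = d + rho - e |z - p|^2, the cube of the positive part of phi is
   C^2 and vanishes near the part of the closure of D away from p, so that it
   extends by 0. *)
Lemma peak_function q D p : (q < N)%N -> open D -> bd D p ->
  strictly_qpseudoconvex_at q D p ->
  exists2 f, PSH2 q (closure D) f &
    forall z, closure D z -> z != p -> (f z < f p)%E.
Proof.
move=> qN oD bDp [U [rho [hdef [rC rpos]]]].
have rp := defining_zero oD bDp hdef.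
have [oU Up _ _ UD] := hdef.
have [P [l [uP l0 nP]]] := pos_eigenvalues_near oU rC Up (rpos p Up).
have nU : nbhs p U by exact: open_nbhs_nbhs.
have [r r0 hr] : exists2 r : R, 0 < r & forall z : Cn R N,
  sqnorm (z - p) <= r ->
    U z /\ forall w, l * sqnorm w <= levi4 rho z (plane_map P w).
  have nUP : nbhs p [set z | U z /\ forall w,
    l * sqnorm w <= levi4 rho z (plane_map P w)].
    by apply: filterS2 nU nP => z Uz Pz; split.
  by have /nbhs_sqnormP := nUP.
(* Subtracting e |z - p|^2 lowers [levi4] by 4 e |w|^2 = l/2 |w|^2, which leaves half of the
   positivity on the frame. *)
pose e := l / 8.
have e0 : 0 < e by rewrite divr_gt0.
(* On the sphere |z - p|^2 = r, where rho <= 0 on the closure of D, phi is at most d - e r = - d,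
   while phi(p) = d > 0. *)
pose d := e * r / 2.
have d0 : 0 < d by rewrite divr_gt0// mulr_gt0.
have [bC blev] := paraboloid_C2 d e p oU.
pose phi z := rho z + paraboloid d e p z.
have phiC : C2_on U phi by exact: C2_add.
have philev z v : U z -> levi4 phi z v = levi4 rho z v - 4 * e * sqnorm v.
  by move=> Uz; rewrite (levi4_add _ oU rC bC Uz) blev.
pose chi (t : R) := Num.max t 0 ^+ 3.
pose chi1 (t : R) := 3 * Num.max t 0 ^+ 2.
pose chi2 (t : R) := 3 * (2 * Num.max t 0).
have dchi (t : R) : is_derive t 1 chi (chi1 t) by exact: (@is_derive_max0X R 1).
have dchi1 (t : R) : is_derive t 1 chi1 (chi2 t).
  have := @is_derive_max0X R 0 t; rewrite expr1 => H.
  exact: (is_deriveZ 3 H).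
have cchi2 : continuous chi2.
  move=> t; apply: cvgM; first exact: cvg_cst.
  apply: cvgM; first exact: cvg_cst.
  exact: (@max0X_continuous R 0 t).
(* The function g is chi(phi) on V1 and 0 on V2. The two sets overlap where phi < 0 inside the ball,
   and the sphere itself is covered, on the closure of D, by the second piece of V2. *)
pose V1 := [set z : Cn R N | sqnorm (z - p) < r].
pose V2 := [set z : Cn R N | r < sqnorm (z - p)] `|` (U `&` [set z | phi z <
  0]).
have oV1 : open V1 by exact: open_sqnorm_lt.
have oV2 : open V2.
  apply: openU; first exact: open_sqnorm_gt.
  rewrite openE => z [Uz pz]; have [cphi _ _] := phiC z Uz.
  have nUz : nbhs z U by exact: open_nbhs_nbhs.
  apply: filterI => //.
  by apply: (cphi [set t | t < 0]); exact: lt_nbhsl.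
pose g z := if sqnorm (z - p) < r then chi (phi z) else 0.
have V1U : V1 `<=` U by move=> z /ltW /hr[].
have gV1 z : V1 z -> (chi \o phi) z = g z by rewrite /g /V1 /= => ->.
have gV2 z : V2 z -> 0 = g z.
  rewrite /g => -[/= h|[_ /= h]]; first by rewrite ltNge (ltW h).
  by case: ifP => // _; rewrite /chi (max_idPr (ltW h)) expr0n.
have cC1 := C2_comp dchi dchi1 cchi2 oU phiC.
have [gC1 glev1] := C2_levi4_eq oV1 (C2_sub V1U cC1) gV1.
have [gC2 glev2] := C2_levi4_eq oV2 (const_C2 V2 (0 : R)).1 gV2.
have gC : C2_on (V1 `|` V2) g by move=> z [/gC1|/gC2].
have KV : closure D `<=` V1 `|` V2.
  move=> z cz; have [zr|zr|zr] := ltgtP (sqnorm (z - p)) r; [by left|by right;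
    left|].
  right; right; have [Uz _] := hr z ltac:(by rewrite zr).
  split=> //=; rewrite /phi /paraboloid zr.
  by have := defining_le0 oU rC UD cz Uz; rewrite /d; nra.
exists (EFin \o g).
  exists (V1 `|` V2), g; split => //; first exact: openU.
  apply: qpsh_of_levi4 => //; first exact: openU.
  move=> z A [V1z|V2z] uA; last first.
    exists (dirx R ord0); first exact: dirx_neq0.
    by rewrite glev2// (const_C2 V2 (0 : R)).2.
  (* The plane has dimension q + 1 and the positive frame N - q, one too many to be disjoint. In a
     common direction both terms of the chain rule are nonnegative, since chi is convex and
     increasing. *)
  have hN : (N < q.+1 + (N - q))%N by lia.
  have [w [w' [w0 ww' wA]]] := frame_meets_plane hN uP uA.
  exists w => //; have Uz := V1U _ V1z.
  rewrite (glev1 _ _ V1z) (levi4_comp dchi dchi1 _ oU phiC Uz).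
  apply: addr_ge0.
    rewrite mulr_ge0 ?addr_ge0 ?sqr_ge0// /chi2 !mulr_ge0// le_max lexx orbT//.
  apply: mulr_ge0; first by rewrite /chi1 mulr_ge0// sqr_ge0.
  rewrite philev// wA sqnorm_plane_map// ww'.
  have [_ /(_ w')] := hr z (ltW V1z); rewrite ww' /e.
  have := mulr_ge0 (ltW l0) (sqnorm_ge0 w).
  by move: (sqnorm w) (levi4 _ _ _) => s t; lra.
have pp : sqnorm (p - p) = 0 by rewrite subrr sqnorm0.
have gp : g p = d ^+ 3.
  rewrite /g pp r0 /phi rp /paraboloid pp mulr0 subr0 add0r.
  by rewrite /chi (max_idPl (ltW d0)).
move=> z cz zp; rewrite /= lte_fin gp /g.
have zp0 : 0 < sqnorm (z - p) by rewrite sqnorm_gt0// subr_eq0.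
case: ifP => [zr|_]; last by rewrite exprn_gt0.
have [Uz _] := hr z (ltW zr).
have := defining_le0 oU rC UD cz Uz => rz.
have pd : phi z < d by rewrite /phi /paraboloid; have := mulr_gt0 e0 zp0; lra.
rewrite /chi ltrXn2r//; first by rewrite le_max lexx orbT.
by rewrite gt_max pd d0.
Qed.

Lemma touchable_not_strict q D y : (q < N)%N -> open D -> C2_boundary D ->
  closure D y ->
  ~ strictly_qpseudoconvex_points q D y -> touchable q (closure D) y.
Proof.
move=> qN oD D_C2 cy nS; have [Dy|nD] := pselect (D y).
  exact: touchable_interior.
have by_ : bd D y by split=> //; rewrite (interior_id _).1.
have [U [rho hdef]] := D_C2 y by_.
by apply: (touchable_boundary qN oD by_ hdef) => h; apply: nS.
Qed.

Lemma compact_closure_bounded D : bounded_set D -> compact (closure D).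
Proof.
move=> [M [_ hM]]; apply: (@bounded_closed_compact_Cn _ _ _ (M + 1)).
  exact: closed_closure.
have cl : closed [set z : Cn R N | `|z| <= M + 1].
  apply: (@preimage_closed _ _ (fun x : Cn R N => `|x|) [set x | x <= M + 1]).
    by move=> x _; exact: norm_continuous.
  exact: closed_le.
have sub : D `<=` [set z : Cn R N | `|z| <= M + 1].
  by move=> z Dz; apply: hM => //; rewrite ltrDl.
by move=> z /(closureS sub); rewrite -(closure_id _).1.
Qed.

Lemma closure_strictly_qpseudoconvex_sub q D :
  closure (strictly_qpseudoconvex_points q D) `<=` closure D.
Proof.
have h : strictly_qpseudoconvex_points q D `<=` closure D by move=> z [[]].
by move=> z /(closureS h); rewrite -(closure_id _).1//; exact: closed_closure.
Qed.

Lemma PSH2_PSH q K : PSH2 q K `<=` PSH q K.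
Proof.
move=> f [V [g [oV KV gC gq fE]]]; split.
  have [ug _] := gq; move=> x Kx; have [h1 h2] := usc_on_sub KV ug Kx.
  rewrite (fE _ Kx); split=> // a /h2; rewrite /within /= => H.
  by apply: (@filterS _ (nbhs x) _ _ _ _ H) => y Hy Ky; rewrite (fE _ Ky);
    exact: Hy.
by exists V, (EFin \o g); split.
Qed.

Lemma closed_boundary_PSH q D : (q < N)%N -> D !=set0 -> open D ->
  bounded_set D ->
  C2_boundary D ->
  closed_boundary (closure D) (PSH q (closure D))
    (closure (strictly_qpseudoconvex_points q D)).
Proof.
move=> qN [z0 Dz0] oD bD D_C2.
set Sb := closure (strictly_qpseudoconvex_points q D); set K := closure D.
have cK : compact K by exact: compact_closure_bounded.
have K0 : K z0 by exact: subset_closure.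
have hT y : K y -> ~ Sb y -> touchable q K y.
  by move=> Ky nS; apply: touchable_not_strict => // h; apply: nS;
    exact: subset_closure.
have cS : closed Sb by exact: closed_closure.
have SK : Sb `<=` K by exact: closure_strictly_qpseudoconvex_sub.
split=> // f [_ [V [v [oV KV qv fE]]]].
have [uv _] := qv.
have uK : usc_on K v := usc_on_sub KV uv.
have [xs Kxs xmax] := usc_max cK (ex_intro _ _ K0) uK.
suff [y Sy vy] : exists2 y, Sb y & v y = v xs.
  exists y; split=> //; split; first exact: SK.
  by move=> x Kx; rewrite (fE _ Kx) (fE _ (SK _ Sy)) vy; exact: xmax.
have [vxs _] := uK xs Kxs.
case E : (v xs) => [M| |].
- apply: (max_meets cK oV KV qv cS SK hT Kxs E) => y Ky.
  by rewrite -E; exact: xmax.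
- by move: vxs; rewrite E ltxx.
(* If the maximum is -oo, then v is -oo on all of K and any point of Sb serves; Sb is seen to be
   nonempty by applying [max_meets] to the constant 0. *)
have q0 : qpsh_on q setT (EFin \o (fun=> 0 : R) : Cn R N -> \bar R).
  apply: qpsh_of_levi4; [exact: openT|exact: (const_C2 setT 0).1|].
  move=> z A _ uA; exists (dirx R ord0); first exact: dirx_neq0.
  by rewrite (const_C2 setT 0).2.
have [y Sy _] : exists2 y, Sb y & (EFin \o (fun=> 0 : R)) y = 0%:E.
  apply: (@max_meets R N q K Sb setT _ xs 0 cK openT _ q0 cS SK hT Kxs erefl)
    => [y //|y _].
  by rewrite /= lexx.
exists y => //; apply/eqP; rewrite -leeNy_eq -E; exact: xmax (SK _ Sy).
Qed.

End PeakFunction.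

Theorem theorem8p9 (R : realType) (N q : nat) (hq : (q < N)%N)
  (D : set (Cn R N)) (D_ne : D !=set0) (D_open : open D)
  (D_conn : connected D) (D_bnd : bounded_set D) (D_C2 : C2_boundary D) :
  shilov (closure D) (PSH q (closure D)) = shilov (closure D) (PSH2 q (closure D)) /\
  shilov (closure D) (PSH2 q (closure D)) =
    closure (strictly_qpseudoconvex_points q D).
Proof.
set K := closure D; set Sb := closure (strictly_qpseudoconvex_points q D).
have PSH_Sb : shilov K (PSH q K) `<=` Sb.
  by move=> z; apply; exact: closed_boundary_PSH.
have PSH2_PSH_shilov : shilov K (PSH2 q K) `<=` shilov K (PSH q K).
  move=> z hz S [cS SK hS]; apply: hz; split=> // f /PSH2_PSH; exact: hS.
have Sb_PSH2 : Sb `<=` shilov K (PSH2 q K).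
  (* Since S is closed it suffices to catch the strict points themselves, and there the peak
     function attains its maximum at p only. *)
  move=> z Sz S [cS SK hS]; have SE : S = closure S by exact/closure_id.
  rewrite SE; move: z Sz; apply: closureS => p [bp sp].
  have [f Ff fmax] := peak_function hq D_open bp sp.
  have [y [Sy [Ky ymax]]] := hS f Ff.
  have [yp|yp] := eqVneq y p; first by rewrite -yp.
  have := ymax p bp.1; rewrite leNgt.
  by rewrite fmax.
split; apply/seteqP; split=> // z.
- by move/PSH_Sb/Sb_PSH2.
- by move/PSH2_PSH_shilov/PSH_Sb.
Qed.
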